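(* The fine-grained concurrent counter contextually refines the coarse-grained one: $$\emptyset\mid\emptyset\vdash\mathsf{counter}_i\precsim_{ctx}\mathsf{counter}_s:(\mathsf{unit}\to\mathsf{int})\times(\mathsf{unit}\to\mathsf{int}).$$
   Context: LANGUAGE. Types: $\tau::=\alpha\mid\mathsf{unit}\mid\mathsf{bool}\mid\mathsf{int}\mid\tau\times\tau\mid\tau+\tau\mid\tau\to\tau\mid\forall\alpha.\tau\mid\exists\alpha.\tau\mid\mu\alpha.\tau\mid\mathsf{ref}\,\tau$. Values: $()$, integers, booleans, locations $\ell$, $(v_1,v_2)$, $\mathsf{inl}(v)$, $\mathsf{inr}(v)$, $\mathsf{rec}\,f\,x=e$, $\Lambda.e$, $\mathsf{pack}\,v$, $\mathsf{fold}\,v$. Expressions: variables, values, $\mathsf{if}$, pairs, projections, $\mathsf{inl}/\mathsf{inr}$, $\mathsf{match}$, application, type application $e\langle\rangle$, $\mathsf{pack}\,e$, $\mathsf{unpack}\,e_1\,\mathsf{in}\,x.e_2$, $\mathsf{fold}\,e$, $\mathsf{unfold}\,e$, $\mathsf{ref}(e)$, $!e$, $e_1\leftarrow e_2$, $\mathsf{CAS}(e_1,e_2,e_3)$, $\mathsf{fork}\{e\}$, and the usual boolean/arithmetic operations. Sugar: $\lambda x.e$ is $\mathsf{rec}\,\_\,x=e$; $\mathsf{let}\,x=e_1\,\mathsf{in}\,e_2$ is $(\lambda x.e_2)\,e_1$; $e_1;e_2$ is $\mathsf{let}\,\_=e_1\,\mathsf{in}\,e_2$. Typing $\Xi\mid\Gamma\vdash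 e:\tau$ ($\Xi$ type variables, $\Gamma$ types of program variables) is standard for System F with recursive functions, iso-recursive types, references and existentials (no type annotations in terms); $\mathsf{CAS}(e_1,e_2,e_3):\mathsf{bool}$ if $e_1:\mathsf{ref}\,\tau$, $e_2,e_3:\tau$ with $\tau$ a unit, boolean, integer or reference type; $\mathsf{fork}\{e\}:\mathsf{unit}$ if $e:\mathsf{unit}$. Semantics: call-by-value (arguments evaluated right to left) with evaluation contexts $K$; a state $\sigma$ is a finite partial map from locations to values; head steps are standard, with $\mathsf{CAS}(\ell,v_1,v_2)$ atomically comparing $\sigma(\ell)$ with $v_1$, returning $\mathsf{true}$ and storing $v_2$ if equal, otherwise returning $\mathsf{false}$. Thread-pool reduction $(\vec e,\sigma)\to_{tp}(\vec e',\sigma')$ takes one step in an arbitrary thread; $K[\mathsf{fork}\{e\}]$ steps to $K[()]$ and appends the new thread $e$ to the pool. CONTEXTUAL REFINEMENT. A program context $\mathcal C$ is an expression with one hole (possibly under binders). $\mathcal C:(\Xi\mid\Gamma\vdash\tau)\Rightarrow(\Xi'\mid\Gamma'\vdash\tau')$ is the standard context typing, derived from the typing rules by treating the hole as a term with $\Xi\mid\Gamma\vdash[\,]:\tau$. $\Xi\mid\Gamma\vdash e_1\precsim_{ctx}e_2:\tau$ means: for all $\tau'$, all $\mathcal C:(\Xi\mid\Gamma\vdash\tau)\Rightarrow(\emptyset\mid\emptyset\vdash\tau')$, all $v,\vec e_f,\sigma$: if $(\mathcal C[e_1],\emptyset)\to_{tp}^*(v::\vec e_f,\sigma)$ then there are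 $v',\vec e_f',\sigma'$ with $(\mathcal C[e_2],\emptyset)\to_{tp}^*(v'::\vec e_f',\sigma')$. PROGRAMS. Spin lock: $\mathsf{newlock}:=\lambda().\,\mathsf{ref}(\mathsf{false})$; $\mathsf{acquire}:=\mathsf{rec}\,acq\,\ell=\mathsf{if}\,\mathsf{CAS}(\ell,\mathsf{false},\mathsf{true})\,\mathsf{then}\,()\,\mathsf{else}\,acq\,\ell$; $\mathsf{release}:=\lambda\ell.\,\ell\leftarrow\mathsf{false}$. $\mathsf{read}:=\lambda c.\,!c$. $\mathsf{inc}_i:=\mathsf{rec}\,inc\,c=\mathsf{let}\,n=\,!c\,\mathsf{in}\,\mathsf{if}\,\mathsf{CAS}(c,n,1+n)\,\mathsf{then}\,n\,\mathsf{else}\,inc\,c$. $\mathsf{counter}_i:=\mathsf{let}\,c=\mathsf{ref}(0)\,\mathsf{in}\,((\lambda().\,\mathsf{read}\,c),(\lambda().\,\mathsf{inc}_i\,c))$. $\mathsf{inc}_s:=\lambda c\,l.\ \mathsf{acquire}\,l;\ \mathsf{let}\,n=\,!c\,\mathsf{in}\ c\leftarrow(1+n);\ \mathsf{release}\,l;\ n$. $\mathsf{counter}_s:=\mathsf{let}\,l=\mathsf{newlock}\,()\,\mathsf{in}\,\mathsf{let}\,c=\mathsf{ref}(0)\,\mathsf{in}\,((\lambda().\,\mathsf{read}\,c),(\lambda().\,\mathsf{inc}_s\,c\,l))$. *)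

(* Defs.v *)
From Stdlib Require Import String Relation_Operators.
From mathcomp Require Import all_boot all_algebra finmap.

Set Implicit Arguments.
Unset Strict Implicit.
Unset Printing Implicit Defensive.

(* Type variables are de Bruijn indices (types are taken up to renaming of
   bound variables); program variables are names. *)
Inductive ty : Type :=
| TVar (i : nat)
| TUnit
| TBool
| TInt
| TProd (A B : ty)
| TSum (A B : ty)
| TArrow (A B : ty)
| TForall (A : ty)
| TExists (A : ty)
| TRec (A : ty)
| TRef (A : ty).

Definition up_ren (r : nat -> nat) (i : nat) : nat :=
  if i is j.+1 then (r j).+1 else 0.

Fixpoint ren_ty (r : nat -> nat) (A : ty) : ty :=
  match A with
  | TVar i => TVar (r i)
  | TUnit => TUnit
  | TBool => TBool
  | TInt => TInt
  | TProd A B => TProd (ren_ty r A) (ren_ty r B)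
  | TSum A B => TSum (ren_ty r A) (ren_ty r B)
  | TArrow A B => TArrow (ren_ty r A) (ren_ty r B)
  | TForall A => TForall (ren_ty (up_ren r) A)
  | TExists A => TExists (ren_ty (up_ren r) A)
  | TRec A => TRec (ren_ty (up_ren r) A)
  | TRef A => TRef (ren_ty r A)
  end.

Definition shift_ty : ty -> ty := ren_ty S.

Definition up_sub (s : nat -> ty) (i : nat) : ty :=
  if i is j.+1 then shift_ty (s j) else TVar 0.

Fixpoint sub_ty (s : nat -> ty) (A : ty) : ty :=
  match A with
  | TVar i => s i
  | TUnit => TUnit
  | TBool => TBool
  | TInt => TInt
  | TProd A B => TProd (sub_ty s A) (sub_ty s B)
  | TSum A B => TSum (sub_ty s A) (sub_ty s B)
  | TArrow A B => TArrow (sub_ty s A) (sub_ty s B)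
  | TForall A => TForall (sub_ty (up_sub s) A)
  | TExists A => TExists (sub_ty (up_sub s) A)
  | TRec A => TRec (sub_ty (up_sub s) A)
  | TRef A => TRef (sub_ty s A)
  end.

(* [inst_ty A B] is A[B/α], where α is the variable of index 0 in A. *)
Definition inst_ty (A B : ty) : ty :=
  sub_ty (fun i => if i is j.+1 then TVar j else B) A.

(* All free type variables of the type are among the first [n]. *)
Fixpoint wf_ty (n : nat) (A : ty) : bool :=
  match A with
  | TVar i => i < n
  | TUnit | TBool | TInt => true
  | TProd A B | TSum A B | TArrow A B => wf_ty n A && wf_ty n B
  | TForall A | TExists A | TRec A => wf_ty n.+1 A
  | TRef A => wf_ty n A
  end.

(* The types whose values can be compared by CAS. *)
Definition cas_ty (A : ty) : bool :=
  match A with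
  | TUnit | TBool | TInt | TRef _ => true
  | _ => false
  end.

Definition loc := nat.

Inductive lit : Type :=
| LUnit
| LBool (b : bool)
| LInt (n : int)
| LLoc (l : loc).

(* [BAnon] is the binder written _ on paper. *)
Inductive binder : Type :=
| BAnon
| BNamed (x : string).

Inductive unop : Type := OpNot | OpOpp.

Inductive binop : Type :=
| OpAdd | OpSub | OpMul | OpEq | OpLe | OpLt | OpAnd | OpOr.

Inductive expr : Type :=
| Var (x : string)
| Lit (a : lit)
| Rec (f x : binder) (e : expr)
| App (e1 e2 : expr)
| UnOp (op : unop) (e : expr)
| BinOp (op : binop) (e1 e2 : expr)
| If (e0 e1 e2 : expr)
| Pair (e1 e2 : expr)
| Fst (e : expr)
| Snd (e : expr)
| InL (e : expr)
| InR (e : expr)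
| Match (e0 : expr) (x1 : binder) (e1 : expr) (x2 : binder) (e2 : expr)
| TLam (e : expr)
| TApp (e : expr)
| Pack (e : expr)
| Unpack (e1 : expr) (x : binder) (e2 : expr)
| Fold (e : expr)
| Unfold (e : expr)
| Alloc (e : expr)
| Deref (e : expr)
| Store (e1 e2 : expr)
| CAS (e1 e2 e3 : expr)
| Fork (e : expr).

Inductive val : Type :=
| LitV (a : lit)
| PairV (v1 v2 : val)
| InLV (v : val)
| InRV (v : val)
| RecV (f x : binder) (e : expr)
| TLamV (e : expr)
| PackV (v : val)
| FoldV (v : val).

Fixpoint of_val (v : val) : expr :=
  match v with
  | LitV a => Lit a
  | PairV v1 v2 => Pair (of_val v1) (of_val v2)
  | InLV v => InL (of_val v)
  | InRV v => InR (of_val v)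
  | RecV f x e => Rec f x e
  | TLamV e => TLam e
  | PackV v => Pack (of_val v)
  | FoldV v => Fold (of_val v)
  end.

Definition binds (x : string) (b : binder) : bool :=
  if b is BNamed y then String.eqb x y else false.

(* [subst x a e] is e[a/x]. It respects shadowing but does not rename bound
   variables; in the reduction of closed programs [a] is always closed. *)
Fixpoint subst (x : string) (a : expr) (e : expr) : expr :=
  match e with
  | Var y => if String.eqb x y then a else Var y
  | Lit c => Lit c
  | Rec f y e => Rec f y (if binds x f || binds x y then e else subst x a e)
  | App e1 e2 => App (subst x a e1) (subst x a e2)
  | UnOp op e => UnOp op (subst x a e)
  | BinOp op e1 e2 => BinOp op (subst x a e1) (subst x a e2)
  | If e0 e1 e2 => If (subst x a e0) (subst x a e1) (subst x a e2)
  | Pair e1 e2 => Pair (subst x a e1) (subst x a e2)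
  | Fst e => Fst (subst x a e)
  | Snd e => Snd (subst x a e)
  | InL e => InL (subst x a e)
  | InR e => InR (subst x a e)
  | Match e0 y1 e1 y2 e2 =>
      Match (subst x a e0)
        y1 (if binds x y1 then e1 else subst x a e1)
        y2 (if binds x y2 then e2 else subst x a e2)
  | TLam e => TLam (subst x a e)
  | TApp e => TApp (subst x a e)
  | Pack e => Pack (subst x a e)
  | Unpack e1 y e2 =>
      Unpack (subst x a e1) y (if binds x y then e2 else subst x a e2)
  | Fold e => Fold (subst x a e)
  | Unfold e => Unfold (subst x a e)
  | Alloc e => Alloc (subst x a e)
  | Deref e => Deref (subst x a e)
  | Store e1 e2 => Store (subst x a e1) (subst x a e2)
  | CAS e1 e2 e3 => CAS (subst x a e1) (subst x a e2) (subst x a e3)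
  | Fork e => Fork (subst x a e)
  end.

Definition bsubst (b : binder) (a : expr) (e : expr) : expr :=
  if b is BNamed x then subst x a e else e.

Definition Lam (x : binder) (e : expr) : expr := Rec BAnon x e.
Definition Let (x : binder) (e1 e2 : expr) : expr := App (Lam x e2) e1.
Definition Seq (e1 e2 : expr) : expr := Let BAnon e1 e2.

Definition state := {fmap loc -> val}.

Definition unop_eval (op : unop) (v : val) : option val :=
  match op, v with
  | OpNot, LitV (LBool b) => Some (LitV (LBool (~~ b)))
  | OpOpp, LitV (LInt n) => Some (LitV (LInt (- n)%R))
  | _, _ => None
  end.

Definition binop_eval (op : binop) (v1 v2 : val) : option val :=
  match v1, v2 with
  | LitV (LInt m), LitV (LInt n) =>
      match op with
      | OpAdd => Some (LitV (LInt (m + n)%R))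
      | OpSub => Some (LitV (LInt (m - n)%R))
      | OpMul => Some (LitV (LInt (m * n)%R))
      | OpEq => Some (LitV (LBool (m == n)))
      | OpLe => Some (LitV (LBool (m <= n)%R))
      | OpLt => Some (LitV (LBool (m < n)%R))
      | _ => None
      end
  | LitV (LBool b), LitV (LBool c) =>
      match op with
      | OpAnd => Some (LitV (LBool (b && c)))
      | OpOr => Some (LitV (LBool (b || c)))
      | _ => None
      end
  | _, _ => None
  end.

(* The last argument lists the threads created by the step. In [S_Beta] the
   argument binder shadows the name of the function. *)
Inductive head_step :
    expr -> state -> expr -> state -> seq expr -> Prop :=
| S_Beta f x e v s :
    head_step (App (Rec f x e) (of_val v)) s
      (bsubst f (Rec f x e) (bsubst x (of_val v) e)) s [::]
| S_UnOp op v w s :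
    unop_eval op v = Some w ->
    head_step (UnOp op (of_val v)) s (of_val w) s [::]
| S_BinOp op v1 v2 w s :
    binop_eval op v1 v2 = Some w ->
    head_step (BinOp op (of_val v1) (of_val v2)) s (of_val w) s [::]
| S_IfTrue e1 e2 s :
    head_step (If (Lit (LBool true)) e1 e2) s e1 s [::]
| S_IfFalse e1 e2 s :
    head_step (If (Lit (LBool false)) e1 e2) s e2 s [::]
| S_Fst v1 v2 s :
    head_step (Fst (Pair (of_val v1) (of_val v2))) s (of_val v1) s [::]
| S_Snd v1 v2 s :
    head_step (Snd (Pair (of_val v1) (of_val v2))) s (of_val v2) s [::]
| S_MatchL v x1 e1 x2 e2 s :
    head_step (Match (InL (of_val v)) x1 e1 x2 e2) s
      (bsubst x1 (of_val v) e1) s [::]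
| S_MatchR v x1 e1 x2 e2 s :
    head_step (Match (InR (of_val v)) x1 e1 x2 e2) s
      (bsubst x2 (of_val v) e2) s [::]
| S_TBeta e s :
    head_step (TApp (TLam e)) s e s [::]
| S_Unpack v x e s :
    head_step (Unpack (Pack (of_val v)) x e) s
      (bsubst x (of_val v) e) s [::]
| S_Unfold v s :
    head_step (Unfold (Fold (of_val v))) s (of_val v) s [::]
| S_Alloc l v (s : state) :
    s.[? l]%fmap = None ->
    head_step (Alloc (of_val v)) s (Lit (LLoc l)) s.[l <- v]%fmap [::]
| S_Deref l v (s : state) :
    s.[? l]%fmap = Some v ->
    head_step (Deref (Lit (LLoc l))) s (of_val v) s [::]
| S_Store l v w (s : state) :
    s.[? l]%fmap = Some w ->
    head_step (Store (Lit (LLoc l)) (of_val v)) s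
      (Lit LUnit) s.[l <- v]%fmap [::]
| S_CASSuc l v1 v2 (s : state) :
    s.[? l]%fmap = Some v1 ->
    head_step (CAS (Lit (LLoc l)) (of_val v1) (of_val v2)) s
      (Lit (LBool true)) s.[l <- v2]%fmap [::]
| S_CASFail l v v1 v2 (s : state) :
    s.[? l]%fmap = Some v -> v <> v1 ->
    head_step (CAS (Lit (LLoc l)) (of_val v1) (of_val v2)) s
      (Lit (LBool false)) s [::]
| S_Fork e s :
    head_step (Fork e) s (Lit LUnit) s [:: e].

(* Frames of evaluation contexts; arguments are evaluated right to left. *)
Inductive ectx_item : Type :=
| EAppL (v2 : val)
| EAppR (e1 : expr)
| EUnOp (op : unop)
| EBinOpL (op : binop) (v2 : val)
| EBinOpR (op : binop) (e1 : expr)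
| EIf (e1 e2 : expr)
| EPairL (v2 : val)
| EPairR (e1 : expr)
| EFst
| ESnd
| EInL
| EInR
| EMatch (x1 : binder) (e1 : expr) (x2 : binder) (e2 : expr)
| ETApp
| EPack
| EUnpack (x : binder) (e2 : expr)
| EFold
| EUnfold
| EAlloc
| EDeref
| EStoreL (v2 : val)
| EStoreR (e1 : expr)
| ECASL (v2 v3 : val)
| ECASM (e1 : expr) (v3 : val)
| ECASR (e1 e2 : expr).

Definition efill_item (k : ectx_item) (e : expr) : expr :=
  match k with
  | EAppL v2 => App e (of_val v2)
  | EAppR e1 => App e1 e
  | EUnOp op => UnOp op e
  | EBinOpL op v2 => BinOp op e (of_val v2)
  | EBinOpR op e1 => BinOp op e1 e
  | EIf e1 e2 => If e e1 e2
  | EPairL v2 => Pair e (of_val v2)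
  | EPairR e1 => Pair e1 e
  | EFst => Fst e
  | ESnd => Snd e
  | EInL => InL e
  | EInR => InR e
  | EMatch x1 e1 x2 e2 => Match e x1 e1 x2 e2
  | ETApp => TApp e
  | EPack => Pack e
  | EUnpack x e2 => Unpack e x e2
  | EFold => Fold e
  | EUnfold => Unfold e
  | EAlloc => Alloc e
  | EDeref => Deref e
  | EStoreL v2 => Store e (of_val v2)
  | EStoreR e1 => Store e1 e
  | ECASL v2 v3 => CAS e (of_val v2) (of_val v3)
  | ECASM e1 v3 => CAS e1 e (of_val v3)
  | ECASR e1 e2 => CAS e1 e2 e
  end.

(* The head of the list is the outermost frame. *)
Definition ectx := seq ectx_item.
Definition efill (K : ectx) (e : expr) : expr := foldr efill_item e K.

Definition config : Type := (seq expr * state)%type.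

Inductive tp_step : config -> config -> Prop :=
| TP_Step (K : ectx) t1 t2 e s e' s' efs :
    head_step e s e' s' efs ->
    tp_step (t1 ++ efill K e :: t2, s) (t1 ++ efill K e' :: t2 ++ efs, s').

Definition tp_steps : config -> config -> Prop :=
  clos_refl_trans_1n config tp_step.

(* The leftmost binding of a variable is the one in scope. *)
Definition env := seq (string * ty).

Fixpoint lookup (x : string) (G : env) : option ty :=
  if G is (y, A) :: G' then
    if String.eqb x y then Some A else lookup x G'
  else None.

Definition bext (b : binder) (A : ty) (G : env) : env :=
  if b is BNamed x then (x, A) :: G else G.

Definition shift_env (G : env) : env := [seq (p.1, shift_ty p.2) | p <- G].

Definition unop_typed (op : unop) (A B : ty) : Prop :=
  match op with
  | OpNot => A = TBool /\ B = TBool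
  | OpOpp => A = TInt /\ B = TInt
  end.

(* Type of the two operands, then type of the result. *)
Definition binop_typed (op : binop) (A B : ty) : Prop :=
  match op with
  | OpAdd | OpSub | OpMul => A = TInt /\ B = TInt
  | OpEq | OpLe | OpLt => A = TInt /\ B = TBool
  | OpAnd | OpOr => A = TBool /\ B = TBool
  end.

(* [typed n G e A] is Ξ | Γ ⊢ e : τ with Ξ = {0, ..., n-1}. *)
Inductive typed : nat -> env -> expr -> ty -> Prop :=
| T_Var n G x A :
    lookup x G = Some A -> typed n G (Var x) A
| T_Unit n G :
    typed n G (Lit LUnit) TUnit
| T_Bool n G b :
    typed n G (Lit (LBool b)) TBool
| T_Int n G m :
    typed n G (Lit (LInt m)) TInt
| T_Rec n G f x e A B :
    wf_ty n (TArrow A B) ->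
    typed n (bext x A (bext f (TArrow A B) G)) e B ->
    typed n G (Rec f x e) (TArrow A B)
| T_App n G e1 e2 A B :
    typed n G e1 (TArrow A B) -> typed n G e2 A ->
    typed n G (App e1 e2) B
| T_UnOp n G op e A B :
    unop_typed op A B -> typed n G e A -> typed n G (UnOp op e) B
| T_BinOp n G op e1 e2 A B :
    binop_typed op A B -> typed n G e1 A -> typed n G e2 A ->
    typed n G (BinOp op e1 e2) B
| T_If n G e0 e1 e2 A :
    typed n G e0 TBool -> typed n G e1 A -> typed n G e2 A ->
    typed n G (If e0 e1 e2) A
| T_Pair n G e1 e2 A B :
    typed n G e1 A -> typed n G e2 B ->
    typed n G (Pair e1 e2) (TProd A B)
| T_Fst n G e A B :
    typed n G e (TProd A B) -> typed n G (Fst e) A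
| T_Snd n G e A B :
    typed n G e (TProd A B) -> typed n G (Snd e) B
| T_InL n G e A B :
    wf_ty n B -> typed n G e A -> typed n G (InL e) (TSum A B)
| T_InR n G e A B :
    wf_ty n A -> typed n G e B -> typed n G (InR e) (TSum A B)
| T_Match n G e0 x1 e1 x2 e2 A B C :
    typed n G e0 (TSum A B) ->
    typed n (bext x1 A G) e1 C -> typed n (bext x2 B G) e2 C ->
    typed n G (Match e0 x1 e1 x2 e2) C
| T_TLam n G e A :
    typed n.+1 (shift_env G) e A -> typed n G (TLam e) (TForall A)
| T_TApp n G e A B :
    wf_ty n B -> typed n G e (TForall A) ->
    typed n G (TApp e) (inst_ty A B)
| T_Pack n G e A B :
    wf_ty n B -> wf_ty n (TExists A) -> typed n G e (inst_ty A B) ->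
    typed n G (Pack e) (TExists A)
| T_Unpack n G e1 x e2 A B :
    wf_ty n B ->
    typed n G e1 (TExists A) ->
    typed n.+1 (bext x A (shift_env G)) e2 (shift_ty B) ->
    typed n G (Unpack e1 x e2) B
| T_Fold n G e A :
    wf_ty n (TRec A) -> typed n G e (inst_ty A (TRec A)) ->
    typed n G (Fold e) (TRec A)
| T_Unfold n G e A :
    typed n G e (TRec A) -> typed n G (Unfold e) (inst_ty A (TRec A))
| T_Alloc n G e A :
    typed n G e A -> typed n G (Alloc e) (TRef A)
| T_Deref n G e A :
    typed n G e (TRef A) -> typed n G (Deref e) A
| T_Store n G e1 e2 A :
    typed n G e1 (TRef A) -> typed n G e2 A ->
    typed n G (Store e1 e2) TUnit
| T_CAS n G e1 e2 e3 A :
    cas_ty A ->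
    typed n G e1 (TRef A) -> typed n G e2 A -> typed n G e3 A ->
    typed n G (CAS e1 e2 e3) TBool
| T_Fork n G e :
    typed n G e TUnit -> typed n G (Fork e) TUnit.

Inductive ctx_item : Type :=
| CRec (f x : binder)
| CAppL (e2 : expr)
| CAppR (e1 : expr)
| CUnOp (op : unop)
| CBinOpL (op : binop) (e2 : expr)
| CBinOpR (op : binop) (e1 : expr)
| CIf (e1 e2 : expr)
| CIfThen (e0 e2 : expr)
| CIfElse (e0 e1 : expr)
| CPairL (e2 : expr)
| CPairR (e1 : expr)
| CFst
| CSnd
| CInL
| CInR
| CMatch (x1 : binder) (e1 : expr) (x2 : binder) (e2 : expr)
| CMatchL (e0 : expr) (x1 : binder) (x2 : binder) (e2 : expr)
| CMatchR (e0 : expr) (x1 : binder) (e1 : expr) (x2 : binder)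
| CTLam
| CTApp
| CPack
| CUnpackL (x : binder) (e2 : expr)
| CUnpackR (e1 : expr) (x : binder)
| CFold
| CUnfold
| CAlloc
| CDeref
| CStoreL (e2 : expr)
| CStoreR (e1 : expr)
| CCASL (e2 e3 : expr)
| CCASM (e1 e3 : expr)
| CCASR (e1 e2 : expr)
| CFork.

Definition fill_item (k : ctx_item) (e : expr) : expr :=
  match k with
  | CRec f x => Rec f x e
  | CAppL e2 => App e e2
  | CAppR e1 => App e1 e
  | CUnOp op => UnOp op e
  | CBinOpL op e2 => BinOp op e e2
  | CBinOpR op e1 => BinOp op e1 e
  | CIf e1 e2 => If e e1 e2
  | CIfThen e0 e2 => If e0 e e2
  | CIfElse e0 e1 => If e0 e1 e
  | CPairL e2 => Pair e e2
  | CPairR e1 => Pair e1 e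
  | CFst => Fst e
  | CSnd => Snd e
  | CInL => InL e
  | CInR => InR e
  | CMatch x1 e1 x2 e2 => Match e x1 e1 x2 e2
  | CMatchL e0 x1 x2 e2 => Match e0 x1 e x2 e2
  | CMatchR e0 x1 e1 x2 => Match e0 x1 e1 x2 e
  | CTLam => TLam e
  | CTApp => TApp e
  | CPack => Pack e
  | CUnpackL x e2 => Unpack e x e2
  | CUnpackR e1 x => Unpack e1 x e
  | CFold => Fold e
  | CUnfold => Unfold e
  | CAlloc => Alloc e
  | CDeref => Deref e
  | CStoreL e2 => Store e e2
  | CStoreR e1 => Store e1 e
  | CCASL e2 e3 => CAS e e2 e3
  | CCASM e1 e3 => CAS e1 e e3
  | CCASR e1 e2 => CAS e1 e2 e
  | CFork => Fork e
  end.

(* The head of the list is the outermost frame; filling may capture free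
   variables of the expression put in the hole. *)
Definition ctx := seq ctx_item.
Definition fill (C : ctx) (e : expr) : expr := foldr fill_item e C.

(* [typed_ctx_item k n G A n' G' A'] is k : (Ξ | Γ ⊢ τ) ⇒ (Ξ' | Γ' ⊢ τ'). *)
Inductive typed_ctx_item :
    ctx_item -> nat -> env -> ty -> nat -> env -> ty -> Prop :=
| TC_Rec n G f x A B :
    wf_ty n (TArrow A B) ->
    typed_ctx_item (CRec f x) n (bext x A (bext f (TArrow A B) G)) B
      n G (TArrow A B)
| TC_AppL n G e2 A B :
    typed n G e2 A ->
    typed_ctx_item (CAppL e2) n G (TArrow A B) n G B
| TC_AppR n G e1 A B :
    typed n G e1 (TArrow A B) ->
    typed_ctx_item (CAppR e1) n G A n G B
| TC_UnOp n G op A B :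
    unop_typed op A B ->
    typed_ctx_item (CUnOp op) n G A n G B
| TC_BinOpL n G op e2 A B :
    binop_typed op A B -> typed n G e2 A ->
    typed_ctx_item (CBinOpL op e2) n G A n G B
| TC_BinOpR n G op e1 A B :
    binop_typed op A B -> typed n G e1 A ->
    typed_ctx_item (CBinOpR op e1) n G A n G B
| TC_If n G e1 e2 A :
    typed n G e1 A -> typed n G e2 A ->
    typed_ctx_item (CIf e1 e2) n G TBool n G A
| TC_IfThen n G e0 e2 A :
    typed n G e0 TBool -> typed n G e2 A ->
    typed_ctx_item (CIfThen e0 e2) n G A n G A
| TC_IfElse n G e0 e1 A :
    typed n G e0 TBool -> typed n G e1 A ->
    typed_ctx_item (CIfElse e0 e1) n G A n G A
| TC_PairL n G e2 A B :
    typed n G e2 B ->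
    typed_ctx_item (CPairL e2) n G A n G (TProd A B)
| TC_PairR n G e1 A B :
    typed n G e1 A ->
    typed_ctx_item (CPairR e1) n G B n G (TProd A B)
| TC_Fst n G A B :
    typed_ctx_item CFst n G (TProd A B) n G A
| TC_Snd n G A B :
    typed_ctx_item CSnd n G (TProd A B) n G B
| TC_InL n G A B :
    wf_ty n B -> typed_ctx_item CInL n G A n G (TSum A B)
| TC_InR n G A B :
    wf_ty n A -> typed_ctx_item CInR n G B n G (TSum A B)
| TC_Match n G x1 e1 x2 e2 A B C :
    typed n (bext x1 A G) e1 C -> typed n (bext x2 B G) e2 C ->
    typed_ctx_item (CMatch x1 e1 x2 e2) n G (TSum A B) n G C
| TC_MatchL n G e0 x1 x2 e2 A B C :
    typed n G e0 (TSum A B) -> typed n (bext x2 B G) e2 C ->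
    typed_ctx_item (CMatchL e0 x1 x2 e2) n (bext x1 A G) C n G C
| TC_MatchR n G e0 x1 e1 x2 A B C :
    typed n G e0 (TSum A B) -> typed n (bext x1 A G) e1 C ->
    typed_ctx_item (CMatchR e0 x1 e1 x2) n (bext x2 B G) C n G C
| TC_TLam n G A :
    typed_ctx_item CTLam n.+1 (shift_env G) A n G (TForall A)
| TC_TApp n G A B :
    wf_ty n B ->
    typed_ctx_item CTApp n G (TForall A) n G (inst_ty A B)
| TC_Pack n G A B :
    wf_ty n B -> wf_ty n (TExists A) ->
    typed_ctx_item CPack n G (inst_ty A B) n G (TExists A)
| TC_UnpackL n G x e2 A B :
    wf_ty n B ->
    typed n.+1 (bext x A (shift_env G)) e2 (shift_ty B) ->
    typed_ctx_item (CUnpackL x e2) n G (TExists A) n G B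
| TC_UnpackR n G e1 x A B :
    wf_ty n B -> typed n G e1 (TExists A) ->
    typed_ctx_item (CUnpackR e1 x)
      n.+1 (bext x A (shift_env G)) (shift_ty B) n G B
| TC_Fold n G A :
    wf_ty n (TRec A) ->
    typed_ctx_item CFold n G (inst_ty A (TRec A)) n G (TRec A)
| TC_Unfold n G A :
    typed_ctx_item CUnfold n G (TRec A) n G (inst_ty A (TRec A))
| TC_Alloc n G A :
    typed_ctx_item CAlloc n G A n G (TRef A)
| TC_Deref n G A :
    typed_ctx_item CDeref n G (TRef A) n G A
| TC_StoreL n G e2 A :
    typed n G e2 A ->
    typed_ctx_item (CStoreL e2) n G (TRef A) n G TUnit
| TC_StoreR n G e1 A :
    typed n G e1 (TRef A) ->
    typed_ctx_item (CStoreR e1) n G A n G TUnit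
| TC_CASL n G e2 e3 A :
    cas_ty A -> typed n G e2 A -> typed n G e3 A ->
    typed_ctx_item (CCASL e2 e3) n G (TRef A) n G TBool
| TC_CASM n G e1 e3 A :
    cas_ty A -> typed n G e1 (TRef A) -> typed n G e3 A ->
    typed_ctx_item (CCASM e1 e3) n G A n G TBool
| TC_CASR n G e1 e2 A :
    cas_ty A -> typed n G e1 (TRef A) -> typed n G e2 A ->
    typed_ctx_item (CCASR e1 e2) n G A n G TBool
| TC_Fork n G :
    typed_ctx_item CFork n G TUnit n G TUnit.

(* The hole behaves as a term with Ξ | Γ ⊢ [] : τ, so it can be used wherever
   such a term can: weakening applies to it as to any other term. Hence a hole
   with closed Ξ | Γ may occur below binders. Since type variables are de Bruijn
   indices, weakening from [n] to [n'] type variables is an injective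
   renaming [r] of the former into the latter. *)
Inductive typed_ctx : ctx -> nat -> env -> ty -> nat -> env -> ty -> Prop :=
| TC_Hole (r : nat -> nat) n G A n' G' :
    injective r ->
    (forall i, i < n -> r i < n') ->
    (forall x B, lookup x G = Some B -> lookup x G' = Some (ren_ty r B)) ->
    typed_ctx [::] n G A n' G' (ren_ty r A)
| TC_Cons k C n1 G1 A1 n2 G2 A2 n3 G3 A3 :
    typed_ctx_item k n2 G2 A2 n3 G3 A3 ->
    typed_ctx C n1 G1 A1 n2 G2 A2 ->
    typed_ctx (k :: C) n1 G1 A1 n3 G3 A3.

Definition ctx_refines (n : nat) (G : env) (e1 e2 : expr) (A : ty) : Prop :=
  forall (A' : ty) (C : ctx),
    typed_ctx C n G A 0 [::] A' ->
  forall (v : val) (efs : seq expr) (s : state),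
    tp_steps ([:: fill C e1], [fmap]%fmap) (of_val v :: efs, s) ->
  exists (v' : val) (efs' : seq expr) (s' : state),
    tp_steps ([:: fill C e2], [fmap]%fmap) (of_val v' :: efs', s').

Local Open Scope string_scope.

Definition newlock : expr := Lam BAnon (Alloc (Lit (LBool false))).

Definition acquire : expr :=
  Rec (BNamed "acq") (BNamed "l")
    (If (CAS (Var "l") (Lit (LBool false)) (Lit (LBool true)))
       (Lit LUnit)
       (App (Var "acq") (Var "l"))).

Definition release : expr :=
  Lam (BNamed "l") (Store (Var "l") (Lit (LBool false))).

Definition read : expr := Lam (BNamed "c") (Deref (Var "c")).

Definition inc_i : expr :=
  Rec (BNamed "inc") (BNamed "c")
    (Let (BNamed "n") (Deref (Var "c"))
       (If (CAS (Var "c") (Var "n") (BinOp OpAdd (Lit (LInt 1)) (Var "n")))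
          (Var "n")
          (App (Var "inc") (Var "c")))).

Definition counter_i : expr :=
  Let (BNamed "c") (Alloc (Lit (LInt 0)))
    (Pair (Lam BAnon (App read (Var "c")))
          (Lam BAnon (App inc_i (Var "c")))).

Definition inc_s : expr :=
  Lam (BNamed "c") (Lam (BNamed "l")
    (Seq (App acquire (Var "l"))
       (Let (BNamed "n") (Deref (Var "c"))
          (Seq (Store (Var "c") (BinOp OpAdd (Lit (LInt 1)) (Var "n")))
             (Seq (App release (Var "l"))
                (Var "n")))))).

Definition counter_s : expr :=
  Let (BNamed "l") (App newlock (Lit LUnit))
    (Let (BNamed "c") (Alloc (Lit (LInt 0)))
       (Pair (Lam BAnon (App read (Var "c")))
             (Lam BAnon (App (App inc_s (Var "c")) (Var "l"))))).

(* Main.v *)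
From Stdlib Require Import String Relation_Operators.
From Stdlib Require List.
Require Import Defs.
From mathcomp Require Import all_boot all_algebra finmap.

(** The configurations reached by the two programs are kept related by a typed,
    purely syntactic congruence [rel]: both sides are built by the same typing
    rules, except where the left-hand side has a counter, or an increment in
    progress, of its own.  The typing is part of the relation because CAS
    compares values up to equality: it is only on values of unit, boolean,
    integer and reference type that related values are equal on the left iff
    they are equal on the right.

    Each step on the left is matched by zero or more steps on the right.  The
    reference of a counter is an ordinary pair of related locations; its lock
    exists on the right only.  An increment does nothing on the right until its
    CAS succeeds on the left; then the whole critical section is run at once on
    the right, so that the lock is free between any two steps on the left. *)

Set Implicit Arguments.
Unset Strict Implicit.
Unset Printing Implicit Defensive.

(** * Substitution in types *)

Lemma sub_ty_ext A s t : s =1 t -> sub_ty s A = sub_ty t A.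
Proof.
elim: A s t => //=; try by [move=> A IHA B IHB s t E; rewrite (IHA s t) ?(IHB s t)
  | move=> A IHA s t E; rewrite (IHA s t)
  | move=> A IHA s t E; rewrite (IHA (up_sub s) (up_sub t)) // => -[|i] //=; rewrite E].
Qed.

Lemma sub_ren_ty A s r : sub_ty s (ren_ty r A) = sub_ty (s \o r) A.
Proof.
elim: A s r => //=; try by [move=> A IHA B IHB s r; rewrite IHA IHB
  | move=> A IHA s r; rewrite IHA
  | move=> A IHA s r; rewrite IHA; congr (_ _); apply: sub_ty_ext => -[|i]].
Qed.

Lemma ren_tyE A r : ren_ty r A = sub_ty (TVar \o r) A.
Proof.
elim: A r => //=; try by [move=> A IHA B IHB r; rewrite IHA IHB
  | move=> A IHA r; rewrite IHA
  | move=> A IHA r; rewrite IHA; congr (_ _); apply: sub_ty_ext => -[|i]].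
Qed.

(** Under a binder two renamings have to be exchanged; the outer one is read as a substitution by
    [ren_tyE], so that [sub_ren_ty] merges them. The law for two substitutions rests on this one in
    the same way. *)
Lemma ren_sub_ty A s r : ren_ty r (sub_ty s A) = sub_ty (ren_ty r \o s) A.
Proof.
have up r' s' : ren_ty (up_ren r') \o up_sub s' =1 up_sub (ren_ty r' \o s').
  by case=> [|i] //=; rewrite /shift_ty !(ren_tyE (ren_ty _ _)) !sub_ren_ty; apply: sub_ty_ext.
elim: A s r => //=; try by [move=> A IHA B IHB s r; rewrite IHA IHB
  | move=> A IHA s r; rewrite IHA
  | move=> A IHA s r; rewrite IHA; congr (_ _); apply: sub_ty_ext].
Qed.

Lemma sub_sub_ty A s t : sub_ty t (sub_ty s A) = sub_ty (sub_ty t \o s) A.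
Proof.
have up t' s' : sub_ty (up_sub t') \o up_sub s' =1 up_sub (sub_ty t' \o s').
  by case=> [|i] //=; rewrite /shift_ty sub_ren_ty ren_sub_ty; apply: sub_ty_ext.
elim: A s t => //=; try by [move=> A IHA B IHB s t; rewrite IHA IHB
  | move=> A IHA s t; rewrite IHA
  | move=> A IHA s t; rewrite IHA; congr (_ _); apply: sub_ty_ext].
Qed.

Lemma sub_ty_wf_id A n s :
  wf_ty n A -> (forall i, i < n -> s i = TVar i) -> sub_ty s A = A.
Proof.
elim: A n s => //=; try by [move=> i n s lt_in ->
  | move=> A IHA B IHB n s /andP[wA wB] E; rewrite (IHA n) ?(IHB n)
  | move=> A IHA n s wA E; rewrite (IHA n)
  | move=> A IHA n s wA E; rewrite (IHA n.+1) // => -[|i] //= lt_in; rewrite E].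
Qed.

Lemma sub_ty_id A s : s =1 TVar -> sub_ty s A = A.
Proof.
elim: A s => //=; try by [move=> A IHA B IHB s E; rewrite (IHA s) ?(IHB s)
  | move=> A IHA s E; rewrite (IHA s)
  | move=> A IHA s E; rewrite (IHA (up_sub s)) // => -[|i] //=; rewrite E].
Qed.

Lemma wf_sub_ty A n m s :
  wf_ty n A -> (forall i, i < n -> wf_ty m (s i)) -> wf_ty m (sub_ty s A).
Proof.
have wf_ren B k l r : wf_ty k B -> (forall i, i < k -> r i < l) -> wf_ty l (ren_ty r B).
  elim: B k l r => //=; try by [move=> i k l r lt_ik; apply
    | move=> B IHB C IHC k l r /andP[wB wC] E; rewrite (IHB k) ?(IHC k)
    | move=> B IHB k l r wB E; rewrite (IHB k)
    | move=> B IHB k l r wB E; apply: (IHB k.+1) => // -[|i] //= lt_ik; apply: E].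
elim: A n m s => //=; try by [move=> i n m s lt_in; apply
  | move=> A IHA B IHB n m s /andP[wA wB] E; rewrite (IHA n) ?(IHB n)
  | move=> A IHA n m s wA E; rewrite (IHA n)
  | move=> A IHA n m s wA E; apply: (IHA n.+1) => // -[|i] //= lt_in;
    apply: (wf_ren _ m) => //; apply: E].
Qed.

Lemma wf_inst_ty n A B : wf_ty n.+1 A -> wf_ty n B -> wf_ty n (inst_ty A B).
Proof. by move=> wA wB; apply: wf_sub_ty wA _ => -[|i]. Qed.

Lemma sub_inst_ty s A B :
  sub_ty s (inst_ty A B) = inst_ty (sub_ty (up_sub s) A) (sub_ty s B).
Proof.
rewrite /inst_ty !sub_sub_ty; apply: sub_ty_ext => -[|i] //=.
by rewrite /shift_ty sub_ren_ty sub_ty_id.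
Qed.

Lemma sub_shift_ty s A : sub_ty (up_sub s) (shift_ty A) = shift_ty (sub_ty s A).
Proof. by rewrite /shift_ty sub_ren_ty ren_sub_ty; apply: sub_ty_ext. Qed.

Lemma inst_shift_ty A B : inst_ty (shift_ty A) B = A.
Proof. by rewrite /inst_ty /shift_ty sub_ren_ty sub_ty_id. Qed.

(** * The simulation relation *)

(* [wlock] holds of the locations, on the right only, of the locks. *)
Record world := World { wloc : loc -> loc -> ty -> Prop; wlock : loc -> Prop }.

Definition wle (W W' : world) : Prop :=
  (forall l l' A, wloc W l l' A -> wloc W' l l' A) /\
  (forall l, wlock W l -> wlock W' l).

(** The expected and the new value are parameters, so that one shape covers the body under the
    binder [n] and its later stages, where integers have replaced [n] and then the sum. *)
Definition inc_body (c : loc) (e1 e2 : expr) : expr :=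
  If (CAS (Lit (LLoc c)) e1 e2) e1 (App inc_i (Lit (LLoc c))).

Definition inc_cont (c : loc) : expr :=
  Lam (BNamed "n"%string)
    (inc_body c (Var "n"%string) (BinOp OpAdd (Lit (LInt 1)) (Var "n"%string))).

(* The stages of [inc_i] between the initial beta step and a CAS. *)
Inductive inc_pending (c : loc) : expr -> Prop :=
| IP_Read :
    inc_pending c (App (inc_cont c) (Deref (Lit (LLoc c))))
| IP_Let m :
    inc_pending c (App (inc_cont c) (Lit (LInt m)))
| IP_Add m :
    inc_pending c
      (inc_body c (Lit (LInt m)) (BinOp OpAdd (Lit (LInt 1)) (Lit (LInt m))))
| IP_CAS m :
    inc_pending c (inc_body c (Lit (LInt m)) (Lit (LInt (1 + m)%R)))
| IP_Retry m :
    inc_pending c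
      (If (Lit (LBool false)) (Lit (LInt m)) (App inc_i (Lit (LLoc c)))).

(** The rules up to [R_Fork] copy the typing rules, with [R_Loc] added for locations. [R_Counter]
    covers counters not yet created; [R_Inc] a call whose argument may still be open or unevaluated;
    [R_Pending] a call under way on the left and not begun on the right. *)
Inductive rel (W : world) : nat -> env -> expr -> expr -> ty -> Prop :=
| R_Var n G x A :
    lookup x G = Some A -> rel W n G (Var x) (Var x) A
| R_Unit n G :
    rel W n G (Lit LUnit) (Lit LUnit) TUnit
| R_Bool n G b :
    rel W n G (Lit (LBool b)) (Lit (LBool b)) TBool
| R_Int n G m :
    rel W n G (Lit (LInt m)) (Lit (LInt m)) TInt
| R_Loc n G l l' A :
    wloc W l l' A -> rel W n G (Lit (LLoc l)) (Lit (LLoc l')) (TRef A)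
| R_Rec n G f x e e' A B :
    wf_ty n (TArrow A B) ->
    rel W n (bext x A (bext f (TArrow A B) G)) e e' B ->
    rel W n G (Rec f x e) (Rec f x e') (TArrow A B)
| R_App n G e1 e1' e2 e2' A B :
    rel W n G e1 e1' (TArrow A B) -> rel W n G e2 e2' A ->
    rel W n G (App e1 e2) (App e1' e2') B
| R_UnOp n G op e e' A B :
    unop_typed op A B -> rel W n G e e' A ->
    rel W n G (UnOp op e) (UnOp op e') B
| R_BinOp n G op e1 e1' e2 e2' A B :
    binop_typed op A B -> rel W n G e1 e1' A -> rel W n G e2 e2' A ->
    rel W n G (BinOp op e1 e2) (BinOp op e1' e2') B
| R_If n G e0 e0' e1 e1' e2 e2' A :
    rel W n G e0 e0' TBool -> rel W n G e1 e1' A -> rel W n G e2 e2' A ->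
    rel W n G (If e0 e1 e2) (If e0' e1' e2') A
| R_Pair n G e1 e1' e2 e2' A B :
    rel W n G e1 e1' A -> rel W n G e2 e2' B ->
    rel W n G (Pair e1 e2) (Pair e1' e2') (TProd A B)
| R_Fst n G e e' A B :
    rel W n G e e' (TProd A B) -> rel W n G (Fst e) (Fst e') A
| R_Snd n G e e' A B :
    rel W n G e e' (TProd A B) -> rel W n G (Snd e) (Snd e') B
| R_InL n G e e' A B :
    wf_ty n B -> rel W n G e e' A -> rel W n G (InL e) (InL e') (TSum A B)
| R_InR n G e e' A B :
    wf_ty n A -> rel W n G e e' B -> rel W n G (InR e) (InR e') (TSum A B)
| R_Match n G e0 e0' x1 e1 e1' x2 e2 e2' A B C :
    rel W n G e0 e0' (TSum A B) ->
    rel W n (bext x1 A G) e1 e1' C -> rel W n (bext x2 B G) e2 e2' C ->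
    rel W n G (Match e0 x1 e1 x2 e2) (Match e0' x1 e1' x2 e2') C
| R_TLam n G e e' A :
    rel W n.+1 (shift_env G) e e' A ->
    rel W n G (TLam e) (TLam e') (TForall A)
| R_TApp n G e e' A B :
    wf_ty n B -> rel W n G e e' (TForall A) ->
    rel W n G (TApp e) (TApp e') (inst_ty A B)
| R_Pack n G e e' A B :
    rel W n G e e' (inst_ty A B) -> wf_ty n B -> wf_ty n (TExists A) ->
    rel W n G (Pack e) (Pack e') (TExists A)
| R_Unpack n G e1 e1' x e2 e2' A B :
    wf_ty n B -> rel W n G e1 e1' (TExists A) ->
    rel W n.+1 (bext x A (shift_env G)) e2 e2' (shift_ty B) ->
    rel W n G (Unpack e1 x e2) (Unpack e1' x e2') B
| R_Fold n G e e' A :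
    wf_ty n (TRec A) -> rel W n G e e' (inst_ty A (TRec A)) ->
    rel W n G (Fold e) (Fold e') (TRec A)
| R_Unfold n G e e' A :
    rel W n G e e' (TRec A) ->
    rel W n G (Unfold e) (Unfold e') (inst_ty A (TRec A))
| R_Alloc n G e e' A :
    rel W n G e e' A -> rel W n G (Alloc e) (Alloc e') (TRef A)
| R_Deref n G e e' A :
    rel W n G e e' (TRef A) -> rel W n G (Deref e) (Deref e') A
| R_Store n G e1 e1' e2 e2' A :
    rel W n G e1 e1' (TRef A) -> rel W n G e2 e2' A ->
    rel W n G (Store e1 e2) (Store e1' e2') TUnit
| R_CAS n G e1 e1' e2 e2' e3 e3' A :
    cas_ty A ->
    rel W n G e1 e1' (TRef A) -> rel W n G e2 e2' A -> rel W n G e3 e3' A ->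
    rel W n G (CAS e1 e2 e3) (CAS e1' e2' e3') TBool
| R_Fork n G e e' :
    rel W n G e e' TUnit -> rel W n G (Fork e) (Fork e') TUnit
| R_Counter n G :
    rel W n G counter_i counter_s
      (TProd (TArrow TUnit TInt) (TArrow TUnit TInt))
| R_Inc n G e e' k :
    wlock W k -> rel W n G e e' (TRef TInt) ->
    rel W n G (App inc_i e) (App (App inc_s e') (Lit (LLoc k))) TInt
| R_Pending n G c c' k e :
    wlock W k -> wloc W c c' TInt -> inc_pending c e ->
    rel W n G e (App (App inc_s (Lit (LLoc c'))) (Lit (LLoc k))) TInt
(* After a successful CAS the specification has already returned. *)
| R_Done n G m e :
    rel W n G (If (Lit (LBool true)) (Lit (LInt m)) e) (Lit (LInt m)) TInt.

(** * Compatibility with contexts and growth of the world *)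

Lemma rel_refl W n G e A : typed n G e A -> rel W n G e e A.
Proof. by elim=> *; econstructor; eassumption. Qed.

(** The hole may lie under binders and see more type variables. The type of the counters has no
    variables, so [ren_ty r] fixes it, and [R_Counter] holds in any environment; frames are handled
    by congruence and [rel_refl]. *)
Lemma rel_fill W C n0 G0 A0 n G A :
  typed_ctx C n0 G0 A0 n G A ->
  A0 = TProd (TArrow TUnit TInt) (TArrow TUnit TInt) ->
  rel W n G (fill C counter_i) (fill C counter_s) A.
Proof.
elim=> {C n0 G0 A0 n G A}.
  by move=> r n G A n' G' _ _ _ ->; apply: R_Counter.
move=> k C n1 G1 A1 n2 G2 A2 n3 G3 A3 tk _ IH /IH /=.
move: (fill C _) (fill C _) => d d' {IH}.
by case: tk => * /=; econstructor; try eassumption; apply: rel_refl; eassumption.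
Qed.

Lemma rel_mono W W' n G e e' A :
  wle W W' -> rel W n G e e' A -> rel W' n G e e' A.
Proof.
by case=> le1 le2; elim=> *; econstructor; try eassumption; auto.
Qed.

(** * Well-formedness of the types of related terms *)

Definition wf_env n (G : env) : Prop :=
  forall x A, lookup x G = Some A -> wf_ty n A.

Lemma wf_bext n b A G : wf_ty n A -> wf_env n G -> wf_env n (bext b A G).
Proof.
by case: b => [|x] //= wA wG y B /=; case: String.eqb => [[<-]|/wG].
Qed.

Definition map_env (f : ty -> ty) (G : env) : env := [seq (p.1, f p.2) | p <- G].

Lemma lookup_map f x G : lookup x (map_env f G) = omap f (lookup x G).
Proof. by elim: G => //= -[y A] G /=; case: String.eqb. Qed.

Lemma map_bext f b A G : map_env f (bext b A G) = bext b (f A) (map_env f G).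
Proof. by case: b. Qed.

Lemma wf_shift n A : wf_ty n.+1 (shift_ty A) = wf_ty n A.
Proof.
have gen B k l r : (forall i, (r i < l) = (i < k)) -> wf_ty l (ren_ty r B) = wf_ty k B.
  elim: B k l r => //=; try by [move=> B IHB C IHC k l r E; rewrite (IHB k) ?(IHC k)
    | move=> B IHB k l r E; apply: IHB
    | move=> B IHB k l r E; apply: IHB => -[|i] //=; rewrite ltnS E].
exact: gen.
Qed.

Lemma wf_shift_env n G : wf_env n G -> wf_env n.+1 (shift_env G).
Proof.
by move=> wG x A; rewrite [shift_env G]/(map_env shift_ty G) lookup_map;
  case E: lookup => [B|] //= [<-]; rewrite wf_shift; apply: wG E.
Qed.

Definition wf_world (W : world) : Prop :=
  forall l l' A, wloc W l l' A -> wf_ty 0 A.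

Lemma wf_ty_le n m A : n <= m -> wf_ty n A -> wf_ty m A.
Proof.
move=> le_nm wA; rewrite -(@sub_ty_wf_id A n TVar wA) //.
by apply: wf_sub_ty wA _ => i /= lt_in; apply: leq_trans le_nm.
Qed.

(** Used at allocation, where the type recorded for the new pair of locations must be closed. *)
Lemma rel_wf W n G e e' A :
  wf_world W -> wf_env n G -> rel W n G e e' A -> wf_ty n A.
Proof.
move=> wW wG r; elim: r wG => {n G e e' A} //=; try by [
    move=> n G l l' A /wW + _; apply: wf_ty_le
  | move=> n G op e e' A B; case: op => -[-> ->]
  | move=> n G op e1 e1' e2 e2' A B; case: op => -[-> ->]
  | move=> n G e1 e1' e2 e2' A B _ IH1 _ _ /IH1 /= /andP[]
  | move=> n G e0 e0' e1 e1' e2 e2' A _ _ _ IH _ _ /IH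
  | move=> n G e1 e1' e2 e2' A B _ IH1 _ IH2 wG; rewrite IH1 ?IH2
  | move=> n G e e' A B _ IH /IH /andP[]
  | move=> n G e e' A B wB _ IH /IH ->; rewrite wB
  ].
- by move=> n G x A E wG; apply: wG E.
- move=> n G e0 e0' x1 e1 e1' x2 e2 e2' A B C _ IH0 _ IH1 _ _ wG.
  by have /= /andP[wA wB] := IH0 wG; apply/IH1/wf_bext.
- by move=> n G e e' A _ IH wG; apply/IH/wf_shift_env.
- by move=> n G e e' A B wB _ IH wG; apply: wf_inst_ty wB; apply: IH.
- by move=> n G e e' A _ IH wG; apply: wf_inst_ty; apply: IH.
Qed.

(** * Weakening and substitution in related terms *)

Lemma rel_weaken W n G G' e e' A :
  rel W n G e e' A -> (forall x B, lookup x G = Some B -> lookup x G' = Some B) ->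
  rel W n G' e e' A.
Proof.
have ext b B H H' : (forall x B, lookup x H = Some B -> lookup x H' = Some B) ->
    (forall x C, lookup x (bext b B H) = Some C -> lookup x (bext b B H') = Some C).
  by case: b => //= y E x C; case: String.eqb => //; apply: E.
have sh H H' : (forall x B, lookup x H = Some B -> lookup x H' = Some B) ->
    (forall x C, lookup x (shift_env H) = Some C -> lookup x (shift_env H') = Some C).
  move=> E x C; rewrite ![shift_env _]/(map_env shift_ty _) !lookup_map.
  by case F: (lookup x H) => [B|] //; rewrite (E _ _ F).
by move=> r; elim: r G' => *; econstructor; eauto.
Qed.

(** Terms carry no types, so they stay the same. A location keeps its recorded type because
    [wf_world] makes that type closed; the CAS rule survives because a type variable is not a
    [cas_ty]. *)
Lemma rel_sub_ty W n m G e e' A s :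
  wf_world W -> rel W n G e e' A -> (forall i, i < n -> wf_ty m (s i)) ->
  rel W m (map_env (sub_ty s) G) e e' (sub_ty s A).
Proof.
move=> wW r; have wup k l t : (forall i, i < k -> wf_ty l (t i)) ->
    forall i, i < k.+1 -> wf_ty l.+1 (up_sub t i).
  by move=> E [|i] //= /E; rewrite wf_shift.
have msh t H : map_env (sub_ty (up_sub t)) (shift_env H) = shift_env (map_env (sub_ty t) H).
  by elim: H => //= -[x B] H /= ->; rewrite sub_shift_ty.
have cst t B : cas_ty B -> cas_ty (sub_ty t B) by case: B.
have wfs k l t B : wf_ty k B -> (forall i, i < k -> wf_ty l (t i)) -> wf_ty l (sub_ty t B).
  exact: wf_sub_ty.
elim: r m s => {n G e e' A} /=; try by [move=> *; econstructor; eauto].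
- by move=> n G x A E m s _; apply: R_Var; rewrite lookup_map E.
- move=> n G l l' A wl m s _.
  by rewrite (@sub_ty_wf_id A 0) //; [apply: R_Loc | apply: wW wl].
- move=> n G f x e e' A B wAB _ IH m s ws.
  by apply: (@R_Rec W m _ f x e e'); [apply: (wfs n _ s (TArrow A B))
    | move: (IH m s ws); rewrite !map_bext].
- move=> n G op e e' A B tAB _ IH m s /IH; case: op tAB => -[-> ->] r;
  by econstructor; try eassumption.
- move=> n G op e1 e1' e2 e2' A B tAB _ IH1 _ IH2 m s ws.
  move: (IH1 m s ws) (IH2 m s ws); case: op tAB => -[-> ->] r1 r2;
  by econstructor; try eassumption.
- move=> n G e0 e0' x1 e1 e1' x2 e2 e2' A B C _ IH0 _ IH1 _ IH2 m s ws.
  by move: (IH0 m s ws) (IH1 m s ws) (IH2 m s ws); rewrite !map_bext /=; apply: R_Match.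
- move=> n G e e' A _ IH m s ws; apply: R_TLam.
  by rewrite -msh; apply/IH/wup.
- move=> n G e e' A B wB _ IH m s ws; rewrite sub_inst_ty.
  by apply: R_TApp; [apply: wfs ws | apply: IH ws].
- move=> n G e e' A B _ IH wB wA m s ws; apply: (@R_Pack W m _ e e' _ (sub_ty s B)).
  + by rewrite -sub_inst_ty; apply: IH.
  + exact: wfs ws.
  + by apply: (wfs n _ s (TExists A)).
- move=> n G e1 e1' x e2 e2' A B wB _ IH1 _ IH2 m s ws.
  apply: (@R_Unpack W m _ _ _ _ _ _ (sub_ty (up_sub s) A)).
  + exact: wfs ws.
  + exact: IH1.
  + by rewrite -msh -map_bext -sub_shift_ty; apply/IH2/wup.
- move=> n G e e' A wA _ IH m s ws; apply: R_Fold.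
  + by apply: (wfs n _ s (TRec A)).
  + by move: (IH m s ws); rewrite sub_inst_ty.
- by move=> n G e e' A _ IH m s ws; rewrite sub_inst_ty; apply/R_Unfold/(IH _ _ ws).
- move=> n G e1 e1' e2 e2' e3 e3' A cA _ IH1 _ IH2 _ IH3 m s ws.
  by apply: R_CAS (cst s A cA) (IH1 _ _ ws) (IH2 _ _ ws) (IH3 _ _ ws).
Qed.

Local Ltac case_eqb :=
  match goal with |- context [String.eqb ?x ?y] => case: (String.eqb x y) end.

Lemma subst_inc_i x a : subst x a inc_i = inc_i.
Proof. by rewrite /=; repeat case_eqb. Qed.

Lemma subst_inc_s x a : subst x a inc_s = inc_s.
Proof. by rewrite /=; repeat case_eqb. Qed.

Lemma subst_counter_i x a : subst x a counter_i = counter_i.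
Proof. by rewrite /=; repeat case_eqb. Qed.

Lemma subst_counter_s x a : subst x a counter_s = counter_s.
Proof. by rewrite /=; repeat case_eqb. Qed.

Lemma subst_inc_pending x a c e : inc_pending c e -> subst x a e = e.
Proof. by case=> * /=; repeat case_eqb. Qed.

Lemma subst_app_inc_i x a e : subst x a (App inc_i e) = App inc_i (subst x a e).
Proof. by rewrite -[LHS]/(App (subst x a inc_i) (subst x a e)) subst_inc_i. Qed.

Lemma subst_app_inc_s x a e c :
  subst x a (App (App inc_s e) (Lit c)) = App (App inc_s (subst x a e)) (Lit c).
Proof.
by rewrite -[LHS]/(App (App (subst x a inc_s) (subst x a e)) (Lit c)) subst_inc_s.
Qed.

(** The environments are compared through [lookup] only, since below further binders the entry of
    [x] is no longer the first. A binder for [x] hides the one place where they differ ([h1]), and a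
    type binder shifts the type of the closed terms put in ([rs]). *)
Lemma rel_subst W n G G0 x a a' A e e' B :
  wf_world W -> rel W n G e e' B ->
  (forall y, lookup y G = if String.eqb y x then Some A else lookup y G0) ->
  rel W n [::] a a' A -> rel W n G0 (subst x a e) (subst x a' e') B.
Proof.
move=> wW r; pose P C H H0 := forall y, lookup y H =
  if String.eqb y x then Some C else lookup y H0.
have h1 b C D H H0 : P C H H0 -> binds x b -> lookup^~ (bext b D H) =1 lookup^~ (bext b D H0).
  case: b => //= z E xz y /=; rewrite E.
  case: (String.eqb_spec y x) => // ->; by rewrite xz.
have h2 b C D H H0 : P C H H0 -> binds x b = false -> P C (bext b D H) (bext b D H0).
  case: b => //= z E xz y /=; rewrite E.
  by case: (String.eqb_spec y x) => // ->; rewrite xz.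
have h3 b D H H0 : lookup^~ H =1 lookup^~ H0 -> lookup^~ (bext b D H) =1 lookup^~ (bext b D H0).
  by case: b => //= z E y /=; rewrite E.
have sh C H H0 : P C H H0 -> P (shift_ty C) (shift_env H) (shift_env H0).
  move=> E y; rewrite ![shift_env _]/(map_env shift_ty _) !lookup_map E.
  by case: String.eqb.
have rs k c c' C : rel W k [::] c c' C -> rel W k.+1 [::] c c' (shift_ty C).
  by move=> rc; rewrite /shift_ty ren_tyE; apply: (rel_sub_ty (G := [::]) wW rc).
have wk k H H0 c c' C : rel W k H c c' C -> lookup^~ H =1 lookup^~ H0 -> rel W k H0 c c' C.
  by move=> rc E; apply: rel_weaken rc _ => y D; rewrite -E.
have bd k b D H H0 C c c' F : P C H H0 -> rel W k (bext b D H) c c' F ->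
    (forall H1, P C (bext b D H) H1 -> rel W k H1 (subst x a c) (subst x a' c') F) ->
    rel W k (bext b D H0) (if binds x b then c else subst x a c)
       (if binds x b then c' else subst x a' c') F.
  move=> E rc IH; case xb: (binds x b); last exact/IH/h2.
  by apply: wk rc _; apply: h1.
rewrite -/(P A G G0) => E ra; elim: r A G0 E ra => {n G e e' B}; try by [
  move=> *; econstructor; eauto].
- move=> n G y B Ey A G0 E ra /=; move: Ey; rewrite E (String.eqb_sym y x).
  case: (String.eqb_spec x y) => [_ [<-]|_ ?]; last exact: R_Var.
  by apply: rel_weaken ra _.
- move=> n G f y e e' B C wBC re IH A G0 E ra /=; apply: R_Rec => //.
  case xf: (binds x f); last first.
    by rewrite /=; apply: (bd _ _ _ _ _ A _ _ _ _ re); [apply: h2 | move=> H1 /IH; apply].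
  by apply: wk re _; apply/h3/h1.
- by move=> *; rewrite subst_counter_i subst_counter_s; apply: R_Counter.
- by move=> n G e e' k wk' _ IH A G0 E ra; rewrite subst_app_inc_i subst_app_inc_s;
    apply: R_Inc => //; apply: IH ra.
- move=> n G c c' k e wk' wc p A G0 E ra.
  by rewrite (subst_inc_pending _ _ p) subst_app_inc_s; apply: R_Pending p.
Qed.

Lemma rel_bsubst W n G b a a' A e e' B :
  wf_world W -> rel W n (bext b A G) e e' B -> rel W n [::] a a' A ->
  rel W n G (bsubst b a e) (bsubst b a' e') B.
Proof. by case: b => [|x] //= wW re; apply: rel_subst re _. Qed.

Local Ltac inv_rel r :=
  inversion r; subst; clear r;
  try match goal with p : inc_pending _ _ |- _ => solve [inversion p] end.

(** The rules special to counters never have a value on their left, so a value can only be related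
    by the rule of its outermost constructor. This gives both the agreement on termination and the
    values that evaluation contexts require on the right. *)
Lemma rel_val W n G v e' A :
  rel W n G (of_val v) e' A -> exists v', e' = of_val v'.
Proof.
elim: v e' A => /= [a|v1 IH1 v2 IH2|v IH|v IH|f x e|e|v IH|v IH] e' A r; inv_rel r;
repeat match goal with
| H : rel _ _ _ (of_val ?v) _ _, IH : forall e' A, rel _ _ _ (of_val ?v) e' A -> _ |- _ =>
  have [? ?] := IH _ _ H; clear H; subst end;
try (eexists (LitV _); reflexivity);
by [eexists (PairV _ _) | eexists (InLV _) | eexists (InRV _) | eexists (RecV _ _ _)
  | eexists (TLamV _) | eexists (PackV _) | eexists (FoldV _)].
Qed.

(** * Simulation *)

Lemma of_val_inj : injective of_val.
Proof.
elim=> [a|v1 IH1 v2 IH2|v IH|v IH|f x e|e|v IH|v IH] [] //= *;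
  match goal with H : _ = _ |- _ => case: H end; intros; subst => //;
  repeat match goal with
  | H : of_val ?v = of_val _, IH : forall w, of_val ?v = of_val w -> _ |- _ =>
    move: (IH _ H) => ->; clear H
  end; by [].
Qed.

(** * Reductions on the right, inside any context and thread pool *)

Lemma tp_steps_trans x y z : tp_steps x y -> tp_steps y z -> tp_steps x z.
Proof. by elim=> // {}x w {}y xw _ IH /IH; apply: rt1n_trans. Qed.

(** Quantifying over the context and the other threads lets a run be replayed under frames and in
    any thread; [efs] lists the threads that it creates. *)
Definition spec_steps (e : expr) (s : state) (efs : seq expr) (e' : expr)
    (s' : state) : Prop :=
  forall K t1 t2,
    tp_steps (t1 ++ efill K e :: t2, s) (t1 ++ efill K e' :: t2 ++ efs, s').

Lemma spec_refl e s : spec_steps e s [::] e s.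
Proof. by move=> K t1 t2; rewrite cats0; apply: rt1n_refl. Qed.

Lemma efill_cat K1 K2 e : efill (K1 ++ K2) e = efill K1 (efill K2 e).
Proof. exact: foldr_cat. Qed.

Lemma spec_head K0 e s e' s' efs :
  head_step e s e' s' efs -> spec_steps (efill K0 e) s efs (efill K0 e') s'.
Proof.
move=> h K t1 t2; rewrite -!efill_cat; apply: rt1n_trans; last exact: rt1n_refl.
exact: TP_Step.
Qed.

Lemma spec_fill K0 e s e' s' efs :
  spec_steps e s efs e' s' -> spec_steps (efill K0 e) s efs (efill K0 e') s'.
Proof. by move=> h K t1 t2; rewrite -!efill_cat; apply: h. Qed.

Lemma spec_trans e s e1 s1 e2 s2 efs :
  spec_steps e s [::] e1 s1 -> spec_steps e1 s1 efs e2 s2 ->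
  spec_steps e s efs e2 s2.
Proof.
move=> h1 h2 K t1 t2; apply: tp_steps_trans (h1 K t1 t2) _.
by rewrite cats0; apply: h2.
Qed.

(** * The invariant between the two states *)

(** By [srel_inj] paired locations form a partial bijection, which makes CAS on references agree.
    Locks are free between steps, and [srel_sep] keeps them out of reach of stores through related
    references. *)
Record srel (W : world) (s s' : state) : Prop := SRel {
  srel_wf : wf_world W;
  srel_inj : forall l1 l1' A1 l2 l2' A2,
    wloc W l1 l1' A1 -> wloc W l2 l2' A2 -> l1 = l2 <-> l1' = l2';
  srel_ty : forall l l1' l2' A1 A2,
    wloc W l l1' A1 -> wloc W l l2' A2 -> A1 = A2;
  srel_val : forall l l' A, wloc W l l' A -> exists v v',
    [/\ s.[? l]%fmap = Some v, s'.[? l']%fmap = Some v'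
      & rel W 0 [::] (of_val v) (of_val v') A];
  srel_lock : forall k, wlock W k -> s'.[? k]%fmap = Some (LitV (LBool false));
  srel_sep : forall k l A, wlock W k -> ~ wloc W l k A }.

Lemma srel_store W s s' l l' A v v' :
  srel W s s' -> wloc W l l' A -> rel W 0 [::] (of_val v) (of_val v') A ->
  srel W s.[l <- v]%fmap s'.[l' <- v']%fmap.
Proof.
case=> wW inj ty vals lock sep wl rv; split=> //.
- move=> l1 l1' A1 wl1; have E := inj _ _ _ _ _ _ wl1 wl.
  rewrite !fnd_set; case: eqP => [e1|n1].
    subst l1; rewrite (proj1 E erefl) eqxx; exists v, v'; split=> //.
    by rewrite (ty _ _ _ _ _ wl1 wl).
  case: eqP => [/E //|_]; exact: vals wl1.
- move=> k wk; rewrite fnd_set; case: eqP => [ek|_]; last exact: lock.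
  by subst k; case: (sep _ _ _ wk wl).
Qed.

Definition add_loc (W : world) (l l' : loc) (A : ty) : world :=
  World (fun m m' B => wloc W m m' B \/ [/\ m = l, m' = l' & B = A]) (wlock W).

Definition add_lock (W : world) (k : loc) : world :=
  World (wloc W) (fun m => wlock W m \/ m = k).

Lemma wle_refl W : wle W W. Proof. by []. Qed.

Lemma wle_trans W1 W2 W3 : wle W1 W2 -> wle W2 W3 -> wle W1 W3.
Proof. by case=> a b [c d]; split; auto. Qed.

Lemma wle_add_loc W l l' A : wle W (add_loc W l l' A).
Proof. by split=> //= *; left. Qed.

Lemma wle_add_lock W k : wle W (add_lock W k).
Proof. by split=> //= *; left. Qed.

(** All recorded locations and locks are allocated, by [srel_val] and [srel_lock], so a pair that is
    fresh on both sides cannot clash with any of them. *)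
Lemma srel_alloc W s s' l l' A v v' :
  srel W s s' -> wf_ty 0 A -> s.[? l]%fmap = None -> s'.[? l']%fmap = None ->
  rel W 0 [::] (of_val v) (of_val v') A ->
  srel (add_loc W l l' A) s.[l <- v]%fmap s'.[l' <- v']%fmap.
Proof.
case=> wW inj ty vals lock sep wA sl sl' rv.
have nl m' B : ~ wloc W l m' B by move/vals=> [w [w' [E _ _]]]; rewrite E in sl.
have nl' m B : ~ wloc W m l' B by move/vals=> [w [w' [_ E _]]]; rewrite E in sl'.
split=> /=.
- by move=> m m' B [/wW //|[_ _ ->]].
- move=> l1 l1' A1 l2 l2' A2 [w1|[-> -> _]] [w2|[-> -> _]] //.
  + exact: inj w1 w2.
  + by split=> E; [case: (nl l1' A1) | case: (nl' l1 A1)]; rewrite -E.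
  + by split=> E; [case: (nl l2' A2) | case: (nl' l2 A2)]; rewrite E.
- move=> m l1' l2' A1 A2 [w1|[E _ ->]] [w2|[E' _ ->]] //.
  + exact: ty w1 w2.
  + by case: (nl l1' A1); rewrite -E'.
  + by case: (nl l2' A2); rewrite -E.
- move=> m m' B [wm|[-> -> ->]]; rewrite !fnd_set.
    case: eqP => [E|_]; first by case: (nl m' B); rewrite -E.
    case: eqP => [E|_]; first by case: (nl' m B); rewrite -E.
    have [w [w' [E1 E2 rw]]] := vals _ _ _ wm; exists w, w'; split=> //.
    exact: rel_mono (wle_add_loc _ _ _ _) rw.
  rewrite !eqxx; exists v, v'; split=> //.
  exact: rel_mono (wle_add_loc _ _ _ _) rv.
- move=> k wk; rewrite fnd_set; case: eqP => [E|_]; last exact: lock.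
  by subst k; rewrite lock in sl'.
- move=> k m B wk [|[_ E _]]; first exact: sep.
  by subst k; rewrite lock in sl'.
Qed.

Lemma srel_add_lock W s s' k :
  srel W s s' -> s'.[? k]%fmap = None ->
  srel (add_lock W k) s s'.[k <- LitV (LBool false)]%fmap.
Proof.
case=> wW inj ty vals lock sep sk.
have nk m B : ~ wloc W m k B by move/vals=> [w [w' [_ E _]]]; rewrite E in sk.
split=> //=.
- move=> m m' B wm; have [w [w' [E1 E2 rw]]] := vals _ _ _ wm.
  exists w, w'; rewrite fnd_set; case: eqP => [E|_].
    by case: (nk m B); rewrite -E.
  by split=> //; apply: rel_mono (wle_add_lock _ _) rw.
- by move=> m [wm|->]; rewrite fnd_set; case: eqP => // _; apply: lock.
- by move=> m l A [wm|->]; [apply: sep | apply: nk].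
Qed.

Lemma fresh_loc (s : state) : exists l, s.[? l]%fmap = None.
Proof.
exists (\max_(l <- domf s) l).+1; apply/not_fnd/negP => ls.
have := @leq_bigmax_seq _ (enum_fset (domf s)) xpredT (fun l : nat => l) _ ls isT.
by rewrite ltnn.
Qed.

(** Values of a comparable type are literals, and a literal other than a location is related only to
    itself. At other types related values may contain different code. *)
Lemma rel_cas_ty W v v' A :
  cas_ty A -> rel W 0 [::] (of_val v) (of_val v') A ->
  if A is TRef B then exists l l',
    [/\ v = LitV (LLoc l), v' = LitV (LLoc l') & wloc W l l' B]
  else v = v'.
Proof.
move=> cA; case: v => [a|v1 v2|v|v|f x e|e|v|v];
  case: v' => [a'|v1' v2'|v'|v'|f' x' e'|e'|v'|v'] /= r; inv_rel r => //.
by do 2!eexists.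
Qed.

Lemma rel_cas W s s' A v v' w w' :
  srel W s s' -> cas_ty A ->
  rel W 0 [::] (of_val v) (of_val v') A -> rel W 0 [::] (of_val w) (of_val w') A ->
  v = w <-> v' = w'.
Proof.
move=> sr cA /(rel_cas_ty cA) rv /(rel_cas_ty cA) rw; case: A cA rv rw => //=;
  try by [move=> _ -> ->].
move=> A _ [l1 [l1' [-> -> w1]]] [l2 [l2' [-> -> w2]]].
have [E1 E2] := srel_inj sr w1 w2.
by split=> -[e]; do 2!congr (_ _); auto.
Qed.

(* Uncontended runs of the specification *)
Local Tactic Notation "spec_at" uconstr(K) uconstr(h) :=
  eapply spec_trans; [eapply (@spec_head K); eapply h | rewrite /=].

Lemma inc_s_steps (s : state) (c k : loc) m :
  s.[? k]%fmap = Some (LitV (LBool false)) ->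
  s.[? c]%fmap = Some (LitV (LInt m)) -> c <> k ->
  spec_steps (App (App inc_s (Lit (LLoc c))) (Lit (LLoc k))) s [::]
    (Lit (LInt m)) s.[c <- LitV (LInt (1 + m)%R)]%fmap.
Proof.
move=> sk sc /eqP ne.
(* The lock is free beforehand, so taking and releasing it leaves no trace: the three writes of the
   critical section amount to the one at [c]. *)
have -> : s.[c <- LitV (LInt (1 + m)%R)]%fmap =
  s.[k <- LitV (LBool true)].[c <- LitV (LInt (1 + m)%R)].[k <- LitV (LBool false)]%fmap.
  apply/fmapP => l; rewrite !fnd_set; case: (eqVneq l k) => // ->.
  by rewrite eq_sym (negbTE ne).
spec_at [:: EAppL (LitV (LLoc k))] (@S_Beta BAnon (BNamed "c"%string) _ (LitV (LLoc c))).
spec_at ([::] : ectx) (@S_Beta BAnon (BNamed "l"%string) _ (LitV (LLoc k))).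
spec_at [:: EAppR _] (@S_Beta (BNamed "acq"%string) (BNamed "l"%string) _ (LitV (LLoc k))).
spec_at [:: EAppR _; EIf _ _]
  (@S_CASSuc k (LitV (LBool false)) (LitV (LBool true)) s sk).
spec_at [:: EAppR _] S_IfTrue.
spec_at ([::] : ectx) (@S_Beta BAnon BAnon _ (LitV LUnit)).
spec_at [:: EAppR _] (@S_Deref c (LitV (LInt m)) s.[k <- LitV (LBool true)]%fmap).
  by rewrite fnd_set (negbTE ne).
spec_at ([::] : ectx) (@S_Beta BAnon (BNamed "n"%string) _ (LitV (LInt m))).
spec_at [:: EAppR _; EStoreR _]
  (@S_BinOp OpAdd (LitV (LInt 1)) (LitV (LInt m)) (LitV (LInt (1 + m)%R))).
  by [].
spec_at [:: EAppR _]
  (@S_Store c (LitV (LInt (1 + m)%R)) (LitV (LInt m)) s.[k <- LitV (LBool true)]%fmap).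
  by rewrite fnd_set (negbTE ne).
spec_at ([::] : ectx) (@S_Beta BAnon BAnon _ (LitV LUnit)).
spec_at [:: EAppR _] (@S_Beta BAnon (BNamed "l"%string) _ (LitV (LLoc k))).
spec_at [:: EAppR _] (@S_Store k (LitV (LBool false)) (LitV (LBool true))).
  by rewrite !fnd_set eqxx (eq_sym k) (negbTE ne).
by spec_at ([::] : ectx) (@S_Beta BAnon BAnon _ (LitV LUnit)); apply: spec_refl.
Qed.

(** Both programs apply this function to their fresh reference; they differ in [inc], which on the
    right contains the location of the lock. *)
Definition counter_pair (inc : expr) : expr :=
  Lam (BNamed "c"%string) (Pair (Lam BAnon (App read (Var "c"))) (Lam BAnon inc)).

(** The run stops just after the allocation of the reference, which is where the left-hand side
    stands once it has allocated its own. *)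
Lemma counter_s_steps (s : state) (c k : loc) :
  s.[? k]%fmap = None ->
  s.[k <- LitV (LBool false)].[? c]%fmap = None ->
  spec_steps counter_s s [::]
    (App (counter_pair (App (App inc_s (Var "c")) (Lit (LLoc k)))) (Lit (LLoc c)))
    s.[k <- LitV (LBool false)].[c <- LitV (LInt 0)]%fmap.
Proof.
move=> sk sc.
spec_at [:: EAppR _] (@S_Beta BAnon BAnon _ (LitV LUnit)).
spec_at [:: EAppR _] (@S_Alloc k (LitV (LBool false)) s sk).
spec_at ([::] : ectx) (@S_Beta BAnon (BNamed "l"%string) _ (LitV (LLoc k))).
spec_at [:: EAppR _] (@S_Alloc c (LitV (LInt 0)) _ sc).
exact: spec_refl.
Qed.

(** * Simulation of head steps *)

(** The unprimed side is already past its step, while the primed side has yet to answer. The answer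
    may take no step and may extend the world. *)
Definition sim W s s' e e' A efs := exists W2 e2' s2' efs',
  [/\ wle W W2, srel W2 s s2', rel W2 0 [::] e e2' A,
      List.Forall2 (fun d d' => rel W2 0 [::] d d' TUnit) efs efs'
    & spec_steps e' s' efs' e2' s2'].

Lemma sim_head W W2 s s' e e' e2' s2' A :
  wle W W2 -> srel W2 s s2' -> rel W2 0 [::] e e2' A ->
  head_step e' s' e2' s2' [::] -> sim W s s' e e' A [::].
Proof.
move=> leW sr r h; exists W2, e2', s2', [::]; split=> //.
exact: (spec_head [::] h).
Qed.

Lemma sim_pure W s s' e e' e2' A :
  srel W s s' -> rel W 0 [::] e e2' A -> head_step e' s' e2' s' [::] ->
  sim W s s' e e' A [::].
Proof. exact: sim_head (wle_refl W). Qed.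

Lemma sim_refl W s s' e e' A :
  srel W s s' -> rel W 0 [::] e e' A -> sim W s s' e e' A [::].
Proof. by move=> sr r; exists W, e', s', [::]; split=> //; apply: spec_refl. Qed.

Lemma rel_inst W G e e' A B :
  wf_world W -> wf_ty 0 B -> rel W 1 G e e' A ->
  rel W 0 (map_env (inst_ty^~ B) G) e e' (inst_ty A B).
Proof. by move=> wW wB r; apply: (rel_sub_ty wW r) => -[|i]. Qed.

Local Ltac inv_vals :=
  repeat match goal with
  | H : rel _ _ _ (of_val ?v) ?e' _ |- _ =>
    is_var e'; let v' := fresh v in have [v' ?] := rel_val H; subst e'
  end.

Local Ltac inv_ctors :=
  repeat match goal with
  | H : rel _ _ _ ?e _ _ |- _ =>
    match e with
    | Rec _ _ _ => idtac | Pair _ _ => idtac | InL _ => idtac | InR _ => idtac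
    | TLam _ => idtac | Pack _ => idtac | Fold _ => idtac | Lit _ => idtac
    end; inv_rel H
  end.

Local Ltac wloc_val sr :=
  match goal with
  | w : wloc _ _ _ _, E : _ = Some _ |- _ =>
    let x := fresh "x" in let Ex := fresh "Ex" in let Ex' := fresh "Ex'" in
    have [x [? [Ex Ex' ?]]] := srel_val sr w; rewrite E in Ex; case: Ex => Ex; subst x
  end.

Local Ltac inv_pending :=
  match goal with p : inc_pending _ _ |- _ => inversion p; subst; clear p end.

Local Ltac val_eq :=
  match goal with
  | H : of_val ?v = _ |- _ => case: v H => //= ? [?]; subst
  | H : _ = of_val ?v |- _ => case: v H => //= ? [?]; subst
  end.

Lemma rel_ref W v e' A :
  rel W 0 [::] (of_val v) e' (TRef A) ->
  exists l l', [/\ v = LitV (LLoc l), e' = Lit (LLoc l') & wloc W l l' A].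
Proof.
move=> r; have [v' E] := rel_val r; subst e'.
by have [l [l' [-> -> wl]]] := rel_cas_ty (A := TRef A) isT r; exists l, l'.
Qed.

Lemma rel_unop W op v v' w A B :
  unop_eval op v = Some w -> unop_typed op A B ->
  rel W 0 [::] (of_val v) (of_val v') A ->
  unop_eval op v' = Some w /\ rel W 0 [::] (of_val w) (of_val w) B.
Proof.
case: op => /= E [EA EB]; subst A B => /rel_cas_ty /= /(_ isT) <-; split=> //.
  by case: v E => //= -[] //= b [<-]; apply: R_Bool.
by case: v E => //= -[] //= b [<-]; apply: R_Int.
Qed.

Lemma rel_binop W op v1 v1' v2 v2' w A B :
  binop_eval op v1 v2 = Some w -> binop_typed op A B ->
  rel W 0 [::] (of_val v1) (of_val v1') A ->
  rel W 0 [::] (of_val v2) (of_val v2') A ->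
  binop_eval op v1' v2' = Some w /\ rel W 0 [::] (of_val w) (of_val w) B.
Proof.
move=> E tAB r1 r2; have cA : cas_ty A by case: op tAB {E} => -[-> _].
have nref : forall C, A <> TRef C by case: op tAB {E} => -[-> _].
have {r1} <- : v1 = v1' by have := rel_cas_ty cA r1; case: A nref {r1 r2 tAB cA} => // C /(_ C).
have {r2} <- : v2 = v2' by have := rel_cas_ty cA r2; case: A nref {r2 tAB cA} => // C /(_ C).
split=> //.
by case: op tAB E => /= -[_ ->]; case: v1 => //= -[] //= b; case: v2 => //= -[] //= b' [<-];
  constructor.
Qed.

Lemma head_sim W e s e2 s2 efs s' e' A :
  head_step e s e2 s2 efs -> srel W s s' -> rel W 0 [::] e e' A ->
  sim W s2 s' e2 e' A efs.
Proof.
case=> {e s e2 s2 efs}.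
- move=> f x e v s sr r; have wW := srel_wf sr; inv_rel r.
  + inv_vals; inv_rel H3.
    apply: (sim_pure sr _ (S_Beta _ _ _ _ _)).
    have rf : rel W 0 [::] (Rec f x e) (Rec f x e') (TArrow A0 A) by apply: R_Rec.
    apply: (rel_bsubst wW _ rf); apply: (rel_bsubst wW); first by eassumption.
    by apply: rel_weaken H6 _.
  + val_eq.
  (* A call of [inc_i] begins: it enters its first pending stage while the right waits. *)
  + have [c [c' [-> -> wc]]] := rel_ref H8.
    by apply: sim_refl => //; apply: R_Pending (IP_Read _).
  + inv_pending; first by val_eq.
    by val_eq; apply: sim_refl => //; apply: R_Pending (IP_Add _ _).
- move=> op v w s E sr r; inv_rel r; inv_vals.
  have [E' rw] := rel_unop E H3 H6.
  by apply: (sim_pure sr rw); apply: S_UnOp.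
- move=> op v1 v2 w s E sr r; inv_rel r; inv_vals.
  have [E' rw] := rel_binop E H4 H7 H8.
  by apply: (sim_pure sr rw); apply: S_BinOp.
- move=> e1 e2 s sr r; inv_rel r; last by apply: sim_refl => //; apply: R_Int.
  by inv_ctors; apply: (sim_pure sr _ (S_IfTrue _ _ _)).
- move=> e1 e2 s sr r; inv_rel r.
    by inv_ctors; apply: (sim_pure sr _ (S_IfFalse _ _ _)).
  (* After a failed CAS the left is again a call that has not begun, as the right has been all
     along. *)
  inv_pending; apply: sim_refl => //; apply: R_Inc => //; exact: R_Loc.
- move=> v1 v2 s sr r; inv_rel r; inv_ctors; inv_vals.
  by apply: (sim_pure sr _ (S_Fst _ _ _)).
- move=> v1 v2 s sr r; inv_rel r; inv_ctors; inv_vals.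
  by apply: (sim_pure sr _ (S_Snd _ _ _)).
- move=> v x1 e1 x2 e2 s sr r; inv_rel r; inv_ctors; inv_vals.
  apply: (sim_pure sr _ (S_MatchL _ _ _ _ _ _)).
  by apply: (rel_bsubst (srel_wf sr)); eassumption.
- move=> v x1 e1 x2 e2 s sr r; inv_rel r; inv_ctors; inv_vals.
  apply: (sim_pure sr _ (S_MatchR _ _ _ _ _ _)).
  by apply: (rel_bsubst (srel_wf sr)); eassumption.
- move=> e s sr r; inv_rel r; inv_ctors.
  apply: (sim_pure sr _ (S_TBeta _ _)).
  by apply: (rel_inst (G := [::]) (srel_wf sr)); eassumption.
- move=> v x e s sr r; inv_rel r; inv_ctors; inv_vals.
  have wW := srel_wf sr; apply: (sim_pure sr _ (S_Unpack _ _ _ _)).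
  (* The witness type is substituted into the body; the type of the result is a shifted one, so the
     instantiation gives it back unchanged. *)
  match goal with
  | w : is_true (wf_ty 0 ?B), r1 : rel _ _ _ _ _ (inst_ty _ ?B), r2 : rel _ 1 _ _ _ _ |- _ =>
    have := rel_inst wW w r2; rewrite map_bext inst_shift_ty => {}r2;
    exact: rel_bsubst wW r2 r1
  end.
- move=> v s sr r; inv_rel r; inv_ctors; inv_vals.
  by apply: (sim_pure sr _ (S_Unfold _ _)).
- move=> l v s sl sr r; inv_rel r; inv_vals.
  have [l' sl'] := fresh_loc s'.
  apply: (sim_head (W2 := add_loc W l l' A0)) (S_Alloc _ sl').
  + exact: wle_add_loc.
  + by apply: srel_alloc => //; apply: (rel_wf (G := [::]) (srel_wf sr)); last eassumption.
  + by apply: R_Loc; right.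
- move=> l v s sl sr r; inv_rel r; inv_ctors; wloc_val sr.
  by apply: sim_pure sr _ (S_Deref _); eassumption.
- move=> l v w s sl sr r; inv_rel r; inv_ctors; inv_vals.
  wloc_val sr.
  apply: (sim_head (W2 := W)) (S_Store _ _); [by [] | | exact: R_Unit | eassumption].
  by apply: srel_store; eassumption.
- move=> l v1 v2 s sl sr r; inv_rel r; inv_ctors; inv_vals.
  have [x [x' [Ex Ex' rx]]] := srel_val sr H6.
  have {Ex} Ex : v1 = x by move: Ex; rewrite sl => -[].
  (* The comparison has the same outcome on both sides because the compared values have a comparable
     type. *)
  subst x; have E : v3 = x' by apply/(rel_cas sr H2 H8 rx).
  subst x'; apply: (sim_head (W2 := W)) (S_CASSuc _ Ex'); [by [] | | exact: R_Bool].
  exact: srel_store H6 H9.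
- move=> l v v1 v2 s sl ne sr r; inv_rel r; inv_ctors; inv_vals.
  have [x [x' [Ex Ex' rx]]] := srel_val sr H6.
  have {Ex} Ex : v = x by move: Ex; rewrite sl => -[].
  subst x; apply: (sim_pure sr) (S_CASFail _ Ex' _); first exact: R_Bool.
  by move/(rel_cas sr H2 rx H8).
- move=> e s sr r; inv_rel r.
  exists W, (Lit LUnit), s', [:: e'0]; split=> //.
  + exact: R_Unit.
  + by constructor.
  + exact: (spec_head [::] (S_Fork _ _)).
Qed.

(** * Locating the redex inside a context *)

Local Ltac val_absurd :=
  match goal with
  | H : of_val ?v = _ |- _ => solve [destruct v; discriminate]
  | H : _ = of_val ?v |- _ => solve [destruct v; discriminate]
  end.

Lemma efill_neq_val K e s e2 s2 efs v :
  head_step e s e2 s2 efs -> efill K e <> of_val v.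
Proof.
move=> h; elim: K v => [|k K IH] v /=; first by case: h => *; case: v.
by case: k => * E; case: v E => //= *; match goal with E : _ = _ |- _ => case: E; intros end;
  eapply IH; eassumption.
Qed.

Local Ltac no_val :=
  match goal with
  | h : head_step ?e _ _ _ _, E : _ = efill _ ?e |- _ => symmetry in E
  | _ => idtac
  end;
  match goal with
  | h : head_step ?e _ _ _ _, E : efill _ ?e = _ |- _ =>
    first [ case: (efill_neq_val h E) | case: (efill_neq_val (v := LitV _) h E)
          | case: (efill_neq_val (v := RecV _ _ _) h E) ]
  end.

Lemma rel_int W v e' :
  rel W 0 [::] (of_val v) e' TInt ->
  exists m, v = LitV (LInt m) /\ e' = Lit (LInt m).
Proof.
by case: v => * /=; match goal with r : rel _ _ _ _ _ _ |- _ => inv_rel r end; eexists.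
Qed.

Local Ltac redex_nil K :=
  case: K => [|[]] //= *; match goal with E : _ = _ |- _ => case: E; intros; no_val end.

Lemma efill_alloc K e s e2 s2 efs a :
  head_step e s e2 s2 efs -> efill K e = Alloc (Lit a) -> K = [::].
Proof. by move=> h; redex_nil K. Qed.

Lemma efill_deref K e s e2 s2 efs a :
  head_step e s e2 s2 efs -> efill K e = Deref (Lit a) -> K = [::].
Proof. by move=> h; redex_nil K. Qed.

Lemma efill_binop K e s e2 s2 efs op a b :
  head_step e s e2 s2 efs -> efill K e = BinOp op (Lit a) (Lit b) -> K = [::].
Proof. by move=> h; redex_nil K. Qed.

Lemma efill_cas K e s e2 s2 efs a b c :
  head_step e s e2 s2 efs -> efill K e = CAS (Lit a) (Lit b) (Lit c) -> K = [::].
Proof. by move=> h; redex_nil K. Qed.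

(** * Steps specific to counters *)

(** The allocation on the left is answered by the creation of both the lock and the reference. From
    then on the two pairs are related by the ordinary rules, with [R_Inc] for the increments. *)
Lemma sim_counter W s s' e2 s2 efs :
  head_step (Alloc (Lit (LInt 0))) s e2 s2 efs -> srel W s s' ->
  sim W s2 s' (App (counter_pair (App inc_i (Var "c"%string))) e2) counter_s
    (TProd (TArrow TUnit TInt) (TArrow TUnit TInt)) efs.
Proof.
move=> h sr; inversion h; subst.
have -> : v = LitV (LInt 0) by case: v H {h} => //= ? [->].
have [k sk] := fresh_loc s'.
(* Freshness is taken after the lock is stored, which makes [c] differ from [k]. *)
have [c sc] := fresh_loc s'.[k <- LitV (LBool false)]%fmap.
pose W2 := add_loc (add_lock W k) l c TInt.
have wk : wlock W2 k by right.
exists W2,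
  (App (counter_pair (App (App inc_s (Var "c"%string)) (Lit (LLoc k)))) (Lit (LLoc c))).
exists s'.[k <- LitV (LBool false)].[c <- LitV (LInt 0)]%fmap, [::]; split=> //.
- exact: wle_trans (wle_add_lock W k) (wle_add_loc _ _ _ _).
- by apply: srel_alloc => //; [apply: srel_add_lock | apply: R_Int].
- have rc G : lookup "c"%string G = Some (TRef TInt) ->
      rel W2 0 G (Var "c"%string) (Var "c"%string) (TRef TInt).
    exact: R_Var.
  have rl : rel W2 0 [::] (Lit (LLoc l)) (Lit (LLoc c)) (TRef TInt) by apply: R_Loc; right.
  apply: R_App rl; apply: R_Rec => //; apply: R_Pair; apply: R_Rec => //=.
    by apply: (R_App (A := TRef TInt)); [apply: R_Rec => //; apply: R_Deref; apply: rc | apply: rc].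
  by apply: R_Inc => //; apply: rc.
- exact: counter_s_steps.
Qed.

(** The whole left-hand term [x] is abstract because its frames need not mirror [K0]: the argument
    of an increment sits under one frame on the left and under two on the right. *)
Lemma sim_frame K0 W s s' d d' B x A efs :
  sim W s s' d d' B efs ->
  (forall W2 a, wle W W2 -> rel W2 0 [::] d a B -> rel W2 0 [::] x (efill K0 a) A) ->
  sim W s s' x (efill K0 d') A efs.
Proof.
move=> [W2 [a [s2' [efs' [le sr r F st]]]]] fr; exists W2, (efill K0 a), s2', efs'.
by split=> //; [apply: fr | apply: spec_fill].
Qed.

Local Tactic Notation "frame" hyp(IH) uconstr(K0) :=
  inv_vals;
  match goal with
  | r : rel ?W _ _ (efill ?K ?e) _ _ |- _ =>
    eapply (@sim_frame K0); [exact: (IH _ _ r) |];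
    let W2 := fresh "W2" in let le := fresh "le" in
    move=> W2 ? le ? /=; econstructor; try eassumption;
    apply: (rel_mono le); eassumption
  end.

(** The third operand of the CAS is evaluated first and is not yet a value, so the sum is the only
    redex. *)
Lemma pending_add_step K e s e2 s2 efs c m :
  head_step e s e2 s2 efs ->
  efill K e = CAS (Lit (LLoc c)) (Lit (LInt m))
    (BinOp OpAdd (Lit (LInt 1)) (Lit (LInt m))) ->
  [/\ efill K e2 = CAS (Lit (LLoc c)) (Lit (LInt m)) (Lit (LInt (1 + m)%R)),
      s2 = s & efs = [::]].
Proof.
move=> h; case: K => [|k K] /= E.
  by subst e; inversion h; exfalso; val_absurd.
case: k E => //= [v2 v3 [_ _ E]|e1 v3 [_ _ E]|e1 e3 [-> -> E]]; try by exfalso; val_absurd.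
have EK := efill_binop h E; subst K; rewrite /= in E *; subst e.
inversion h; subst.
have E1 : v1 = LitV (LInt 1) by apply: of_val_inj.
have E2 : v2 = LitV (LInt m) by apply: of_val_inj.
by subst v1 v2; match goal with E : binop_eval _ _ _ = _ |- _ => case: E => <- end.
Qed.

(** The linearization point. Related cells hold the same integer, so when the CAS succeeds the
    critical section on the right reads the same [m], stores the same [1 + m] and returns [m]. When
    it fails the right does nothing. *)
Lemma sim_pending_cas W s s' e2 s2 efs c c' k m :
  head_step (CAS (Lit (LLoc c)) (Lit (LInt m)) (Lit (LInt (1 + m)%R))) s e2 s2 efs ->
  srel W s s' -> wlock W k -> wloc W c c' TInt ->
  sim W s2 s' (If e2 (Lit (LInt m)) (App inc_i (Lit (LLoc c))))
    (App (App inc_s (Lit (LLoc c'))) (Lit (LLoc k))) TInt efs.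
Proof.
move=> h sr wk wc; have [v [v' [E E' rv]]] := srel_val sr wc.
have [n [Ev Ev']] := rel_int rv.
have {}Ev' : v' = LitV (LInt n) by apply: of_val_inj.
subst v v'; inversion h; subst.
- have E1 : v1 = LitV (LInt m) by apply: of_val_inj.
  have E2 : v2 = LitV (LInt (1 + m)%R) by apply: of_val_inj.
  subst v1 v2; have [nm] : Some (LitV (LInt n)) = Some (LitV (LInt m)) by congruence.
  subst n; exists W, (Lit (LInt m)), s'.[c' <- LitV (LInt (1 + m)%R)]%fmap, [::].
  split=> //.
  + by apply: srel_store wc _ => //; apply: R_Int.
  + exact: R_Done.
  + apply: (inc_s_steps (srel_lock sr wk) E').
    by move=> ck; apply: (srel_sep sr wk); rewrite -ck; exact: wc.
- have E1 : v1 = LitV (LInt m) by apply: of_val_inj.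
  by subst v1; apply: sim_refl => //; apply: R_Pending (IP_Retry _ _).
Qed.

(** Induction on the context: a frame coming from a congruence rule has its counterpart on the
    right, and the step passes through it. Only application and conditional frames may belong to a
    counter, to a call of its increment or to a pending increment. *)
Lemma sim_step K e s e2 s2 efs W s' e' A :
  head_step e s e2 s2 efs -> srel W s s' -> rel W 0 [::] (efill K e) e' A ->
  sim W s2 s' (efill K e2) e' A efs.
Proof.
move=> h sr; elim: K e' A => [|k K IH] e' A /=; first by move=> r; apply: (head_sim h sr r).
case: k => /=.
- move=> v2 r; inv_rel r.
  + frame IH [:: EAppL _].
  + by exfalso; val_absurd.
  + by exfalso; no_val.
  + by exfalso; inv_pending; no_val.
- move=> e1 r; inv_rel r.
  + frame IH [:: EAppR _].
  + match goal with E : Alloc _ = efill _ _ |- _ =>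
      have EK := efill_alloc h (esym E); subst K; move: E h => /= <- h
    end.
    exact: sim_counter h sr.
  + apply: (@sim_frame [:: EAppL (LitV (LLoc k)); EAppR inc_s] _ _ _ _ _ _ _ _ _ (IH _ _ H6)).
    by move=> W2 a le ra; apply: R_Inc => //; apply: le.2.
  + inv_pending; last by exfalso; no_val.
    (* The read of a pending increment: the cell holds some integer, which need not last until the
       CAS, so the right does not move. *)
    match goal with E : Deref _ = efill _ _ |- _ =>
      have EK := efill_deref h (esym E); subst K; move: E h => /= <- h
    end.
    have [v1 [v2 [E1 _ rv]]] := srel_val sr H0; inversion h; subst.
    have {E1} E1 : v = v1 by congruence.
    subst v1; have [m [-> _]] := rel_int rv.
    by apply: sim_refl => //; apply: R_Pending (IP_Let _ _).
- move=> op r; inv_rel r; frame IH [:: EUnOp op].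
- move=> op v2 r; inv_rel r; frame IH [:: EBinOpL op _].
- move=> op e1 r; inv_rel r; frame IH [:: EBinOpR op _].
- move=> e1 e3 r; inv_rel r.
  + frame IH [:: EIf _ _].
  + inv_pending; last by exfalso; no_val.
    * have [-> -> ->] := pending_add_step h (esym H3).
      by apply: sim_refl => //; apply: R_Pending (IP_CAS _ _).
    * have EK := efill_cas h (esym H3); subst K; move: H3 h => /= <- h.
      exact: (sim_pending_cas h sr).
  + by exfalso; no_val.
- move=> v2 r; inv_rel r; frame IH [:: EPairL _].
- move=> e1 r; inv_rel r; frame IH [:: EPairR _].
- move=> r; inv_rel r; frame IH [:: EFst].
- move=> r; inv_rel r; frame IH [:: ESnd].
- move=> r; inv_rel r; frame IH [:: EInL].
- move=> r; inv_rel r; frame IH [:: EInR].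
- move=> x1 e1 x2 e3 r; inv_rel r; frame IH [:: EMatch x1 _ x2 _].
- move=> r; inv_rel r; frame IH [:: ETApp].
- move=> r; inv_rel r; frame IH [:: EPack].
- move=> x e1 r; inv_rel r; frame IH [:: EUnpack x _].
- move=> r; inv_rel r; frame IH [:: EFold].
- move=> r; inv_rel r; frame IH [:: EUnfold].
- move=> r; inv_rel r; frame IH [:: EAlloc].
- move=> r; inv_rel r; frame IH [:: EDeref].
- move=> v2 r; inv_rel r; frame IH [:: EStoreL _].
- move=> e1 r; inv_rel r; frame IH [:: EStoreR _].
- move=> v2 v3 r; inv_rel r; frame IH [:: ECASL _ _].
- move=> e1 v3 r; inv_rel r; frame IH [:: ECASM _ _].
- move=> e1 e3 r; inv_rel r; frame IH [:: ECASR _ _].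
Qed.

(** * Thread pools and termination *)

(** The thread that moves is answered in place, and the others remain related in the larger world by
    [rel_mono]. Each thread has its own type, which is [TUnit] for those created by a fork. *)
Lemma sim_tp_step W t s t2 s2 t' s' :
  tp_step (t, s) (t2, s2) -> srel W s s' ->
  List.Forall2 (fun e e' => exists A, rel W 0 [::] e e' A) t t' ->
  exists W2 t2' s2',
    [/\ srel W2 s2 s2', tp_steps (t', s') (t2', s2')
      & List.Forall2 (fun e e' => exists A, rel W2 0 [::] e e' A) t2 t2'].
Proof.
move=> st sr F; inversion st; subst.
have [l1' [l2' [F1 [F2 ->]]]] := List.Forall2_app_inv_l _ _ F.
inversion F2 as [|e0 d0' t0' u' [A rA] F4]; subst.
have [W2 [e2' [s2' [efs' [le sr2 r2 F3 st']]]]] := sim_step H0 sr rA.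
have mono l l' : List.Forall2 (fun e e' => exists A, rel W 0 [::] e e' A) l l' ->
    List.Forall2 (fun e e' => exists A, rel W2 0 [::] e e' A) l l'.
  by apply: List.Forall2_impl => a b [B rB]; exists B; apply: rel_mono rB.
do 3!eexists; split; [exact: sr2 | exact: (st' [::]) |].
apply: List.Forall2_app; first exact: mono.
constructor; first by exists A.
apply: List.Forall2_app; first exact: mono.
by apply: List.Forall2_impl F3 => a b rab; exists TUnit.
Qed.

Lemma sim_tp_steps W c c2 t' s' :
  tp_steps c c2 -> srel W c.2 s' ->
  List.Forall2 (fun e e' => exists A, rel W 0 [::] e e' A) c.1 t' ->
  exists W2 t2' s2',
    tp_steps (t', s') (t2', s2') /\
    List.Forall2 (fun e e' => exists A, rel W2 0 [::] e e' A) c2.1 t2'.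
Proof.
move=> st; elim: st W t' s' => {c c2} [c|[t s] [t2 s2] c3 h _ IH] W t' s' sr F.
  by exists W, t', s'; split=> //; apply: rt1n_refl.
have [W2 [t2' [s2' [sr2 st2 F2]]]] := sim_tp_step h sr F.
have [W3 [t3' [s3' [st3 F3]]]] := IH _ _ _ sr2 F2.
by exists W3, t3', s3'; split=> //; apply: tp_steps_trans st3.
Qed.

Theorem mainTheorem7 :
  ctx_refines 0 [::] counter_i counter_s
    (TProd (TArrow TUnit TInt) (TArrow TUnit TInt)).
Proof.
move=> A' C tC v efs s st.
(* Both heaps start empty, so the initial world has no locations and no locks. *)
pose W := World (fun _ _ _ => False) (fun _ => False).
have sr : srel W [fmap]%fmap [fmap]%fmap by split.
have r : rel W 0 [::] (fill C counter_i) (fill C counter_s) A' by apply: rel_fill tC _.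
have [W2 [t2' [s2' [st2 F]]]] : exists W2 t2' s2',
    tp_steps ([:: fill C counter_s], [fmap]%fmap) (t2', s2') /\
    List.Forall2 (fun e e' => exists A, rel W2 0 [::] e e' A) (of_val v :: efs) t2'.
  apply: (sim_tp_steps st sr); constructor; last by constructor.
  by exists A'.
inversion F; subst; match goal with H : exists A, _ |- _ => case: H => A rA end.
(* The first thread on the left is a value, hence so is the related first thread on the right. *)
by have [v' Ev] := rel_val rA; subst; exists v'; do 2!eexists; exact: st2.
Qed.
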